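(* Let $V$ be a potential on $X$ which is nondeterministic (i.e. not $\mathbb{P}$-a.s. equal to a constant) and weakly differentiable with $\|\nabla V\|_\infty<\infty$. Assume there are constants $v_{\min},v_{\max}$ with $0<v_{\min}\le V\le v_{\max}<\infty$. Then for every $y\in\mathbb{R}^d$ with $y\neq 0$, $$\Gamma_V(y)<\Gamma_{\mathbb{E}V}(y),$$ where $\Gamma_{\mathbb{E}V}$ is the functional for the constant potential $\mathbb{E}V$.
   Context: Let $d\in\mathbb{N}$ and let $X=(\Omega,\mathcal{F},\mathbb{P},\tau)$ be a metric dynamical system: $(\Omega,\mathcal{F},\mathbb{P})$ is a probability space, $\tau:\mathbb{R}^d\times\Omega\to\Omega$, $(x,\omega)\mapsto\tau_x\omega$, is a product measurable action of the group $(\mathbb{R}^d,+)$ on $\Omega$, and $\mathbb{P}$ is invariant under $\tau_x$ for all $x\in\mathbb{R}^d$. $\mathbb{E}$ is expectation w.r.t. $\mathbb{P}$, $L^p=L^p(\Omega,\mathcal{F},\mathbb{P})$. A potential is a nonnegative $V\in L^1$. For a measurable function $f$ on $\Omega$ its realisations are $f_\omega(x):=f(\tau_x\omega)$, $x\in\mathbb{R}^d$, $\omega\in\Omega$. If $f_\omega$ is differentiable for all $\omega$, put $(Df)(\omega):=D(f_\omega)(0)$; higher derivatives $D^nf$, the gradient $\nabla f$ and the divergence $\nabla\cdot\phi$ of vector fields are defined in the same way. A measurable $f$ is weakly differentiable in direction $i$ if $\mathbb{P}$-a.e. realisation of $f$ is weakly differentiable in direction $i$ and there is a measurable $g$ on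 $\Omega$ such that $\mathbb{P}$-a.s., Lebesgue-a.e., $g_\omega=\partial_i(f_\omega)$; then $\partial_if:=g$. $f$ is weakly differentiable if this holds in every direction, and then $\nabla f:=(\partial_if)_{i}$. Let $\mathbb{F}$ be the set of $f\in L^1$ such that $\mathbb{E}f=1$, there is $c_f>0$ with $f\ge c_f$, $f_\omega$ is differentiable of any order for all $\omega$, and $\sup_\Omega|D^nf|<\infty$ for all $n\in\mathbb{N}_0$. For $y\in\mathbb{R}^d$ let $\Phi_y$ be the set of $\phi\in(L^1)^d$ such that $\phi_\omega$ is differentiable of any order for all $\omega$, $\sup_\Omega|D^n\phi|<\infty$ for all $n\in\mathbb{N}_0$, $\mathbb{E}\phi=y$, and $\nabla\cdot\phi=0$ for all $\omega$. Define $$\Gamma_V(y):=2\inf_{f\in\mathbb{F}}\left[\left(\int\frac{|\nabla f|^2}{8f}+Vf\,d\mathbb{P}\right)\left(\inf_{\phi\in\Phi_y}\int\frac{|\phi|^2}{2f}\,d\mathbb{P}\right)\right]^{1/2}.$$ *)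

(* Defs.v *)
From HB Require Import structures.
From mathcomp Require Import all_boot all_order all_algebra.
From mathcomp Require Import all_classical all_reals all_analysis.

Set Implicit Arguments.
Unset Strict Implicit.
Unset Printing Implicit Defensive.
Import Order.TTheory GRing.Theory Num.Theory.
Import numFieldNormedType.Exports.

Local Open Scope classical_set_scope.
Local Open Scope ring_scope.

(* R^n is 'rV[R]_n. It carries the sigma-algebra generated by the coordinate
   maps, i.e. the product Borel sigma-algebra (same encoding as n.-tuple T in
   measurable_structure.v), and the Lebesgue measure defined by recursion on n
   as an iterated product measure. Beware that the library norm `|x| on
   'rV[R]_n is the sup norm: the Euclidean norm is [enorm] below. *)

Section measurable_rV.
Context {R : realType}.
Variable n : nat.

Definition rV_coord (i : 'I_n) (x : 'rV[R]_n) : R := x ord0 i.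

Let rV_set0 : g_sigma_preimage rV_coord set0.
Proof. exact: sigma_algebra0. Qed.

Let rV_setC A : g_sigma_preimage rV_coord A -> g_sigma_preimage rV_coord (~` A).
Proof. exact: sigma_algebraC. Qed.

Let rV_bigcup (F : (set 'rV[R]_n)^nat) :
  (forall i, g_sigma_preimage rV_coord (F i)) ->
  g_sigma_preimage rV_coord (\bigcup_i (F i)).
Proof. exact: sigma_algebra_bigcup. Qed.

HB.instance Definition _ := @isMeasurable.Build default_measure_display
  'rV[R]_n (g_sigma_preimage rV_coord) rV_set0 rV_setC rV_bigcup.

End measurable_rV.

Lemma measurable_rV_coord (R : realType) n (i : 'I_n) :
  measurable_fun [set: 'rV[R]_n] (@rV_coord R n i).
Proof.
move=> _ Y mY; rewrite setTI; apply: sub_sigma_algebra => /=.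
rewrite -bigcup_seq/=; exists i => /=; first by rewrite mem_index_enum.
by exists Y => //; rewrite setTI.
Qed.

Lemma measurable_fun_rVP (R : realType) n d (T : measurableType d)
    (f : T -> 'rV[R]_n) :
  measurable_fun setT f <-> forall i, measurable_fun setT (rV_coord i \o f).
Proof.
split=> [mf i|mf].
  by apply: measurableT_comp mf; exact: measurable_rV_coord.
move=> _ Y mY; rewrite setTI.
have : preimage_set_system setT f (g_sigma_preimage (@rV_coord R n)) (f @^-1` Y).
  by exists Y => //; rewrite setTI.
rewrite -g_sigma_preimage_comp.
apply: (_ : _ `<=` measurable).
apply: smallest_sub; first exact: sigma_algebra_measurable.
case: n f mf Y mY => [|n] f mf Y mY; first by rewrite big_ord0.
rewrite -bigcup_mkord_ord; apply: bigcup_sub => i Ii.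
by move=> A [B mB <-]; exact: mf.
Qed.

Section rV_cons.
Context {R : realType} (n : nat).

Definition rV_cons (p : R * 'rV[R]_n) : 'rV[R]_n.+1 :=
  \row_i (if unlift ord0 i is Some j then p.2 ord0 j else p.1).

Definition rV_uncons (x : 'rV[R]_n.+1) : R * 'rV[R]_n :=
  (x ord0 ord0, \row_i x ord0 (lift ord0 i)).

Lemma rV_cons0 p : rV_cons p ord0 ord0 = p.1.
Proof. by rewrite mxE unlift_none. Qed.

Lemma rV_consS p (i : 'I_n) : rV_cons p ord0 (lift ord0 i) = p.2 ord0 i.
Proof. by rewrite mxE liftK. Qed.

Lemma rV_consK : cancel rV_cons rV_uncons.
Proof.
case=> a x; rewrite /rV_uncons rV_cons0; congr pair.
by apply/rowP => i; rewrite mxE rV_consS.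
Qed.

Lemma rV_unconsK : cancel rV_uncons rV_cons.
Proof.
move=> x; apply/rowP => i; case: (unliftP ord0 i) => [j|] ->.
  by rewrite rV_consS mxE.
by rewrite rV_cons0.
Qed.

Lemma measurable_rV_cons : measurable_fun setT rV_cons.
Proof.
apply/measurable_fun_rVP => i; case: (unliftP ord0 i) => [j|] ->.
  rewrite (_ : _ \o _ = @rV_coord R n j \o snd).
    by apply: measurableT_comp => //; exact: measurable_rV_coord.
  by apply/funext => p /=; rewrite /rV_coord rV_consS.
rewrite (_ : _ \o _ = fst) //.
by apply/funext => p /=; rewrite /rV_coord rV_cons0.
Qed.

Lemma measurable_rV_uncons : measurable_fun setT rV_uncons.
Proof.
apply/measurable_fun_pair; first exact: (measurable_rV_coord (n := n.+1)).
apply/measurable_fun_rVP => i.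
rewrite (_ : _ \o _ = @rV_coord R n.+1 (lift ord0 i)).
  exact: measurable_rV_coord.
by apply/funext => x /=; rewrite /rV_coord mxE.
Qed.

End rV_cons.

Section lebesgue_rV_step.
Local Open Scope ereal_scope.
Context {R : realType} (n : nat).
Variable m : {sigma_finite_measure set 'rV[R]_n -> \bar R}.

Definition lebesgue_rV_step : set 'rV[R]_n.+1 -> \bar R :=
  pushforward ((@lebesgue_measure R) \x m) (@rV_cons R n).

Let step0 : lebesgue_rV_step set0 = 0.
Proof. by rewrite /lebesgue_rV_step /pushforward preimage_set0 measure0. Qed.

Let step_ge0 A : 0 <= lebesgue_rV_step A.
Proof. by apply: measure_ge0; exact: measurable_rV_cons. Qed.

Let step_sigma_additive : semi_sigma_additive lebesgue_rV_step.
Proof.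
apply: measure_semi_sigma_additive; exact: measurable_rV_cons.
Qed.

HB.instance Definition _ := isMeasure.Build _ _ _ lebesgue_rV_step
  step0 step_ge0 step_sigma_additive.

Let step_sigma_finite : sigma_finite setT lebesgue_rV_step.
Proof.
have /sigma_finiteP[F [FT ndF Foo]] := sigma_finiteT (@lebesgue_measure R).
have /sigma_finiteP[G [GT ndG Goo]] := sigma_finiteT m.
exists (fun k => @rV_uncons R n @^-1` (F k `*` G k)).
  rewrite -preimage_bigcup (_ : \bigcup_k _ = setT) ?preimage_setT//.
  rewrite -setXTT FT GT predeqE => -[x y]; split.
    by move=> [k _ []/= ? ?]; split; exists k.
  move=> [/= [k _ Fkx] [l _ Gly]]; exists (maxn k l) => //; split.
  - by move: x Fkx; exact/subsetPset/ndF/leq_maxl.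
  - by move: y Gly; exact/subsetPset/ndG/leq_maxr.
move=> k; have [mF Fkoo] := Foo k; have [mG Gkoo] := Goo k; split.
  rewrite -[X in measurable X]setTI; apply: measurable_rV_uncons => //.
  exact: measurableX.
rewrite /lebesgue_rV_step /pushforward -comp_preimage.
rewrite (_ : _ \o _ = id); last by apply/funext => p /=; rewrite rV_consK.
by rewrite preimage_id product_measure1E// lte_mul_pinfty// ge0_fin_numE.
Qed.

HB.instance Definition _ := Measure_isSigmaFinite.Build _ _ _ lebesgue_rV_step
  step_sigma_finite.

End lebesgue_rV_step.

Fixpoint lebesgue_rV (R : realType) (n : nat) :
    {sigma_finite_measure set 'rV[R]_n -> \bar R} :=
  if n is k.+1 then lebesgue_rV_step (lebesgue_rV R k) else \d_(0 : 'rV[R]_0).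

Section calculus.
Context {R : realType} {d : nat}.

Definition enorm (v : 'rV[R]_d) : R := Num.sqrt (\sum_(i < d) v ord0 i ^+ 2).

Definition partial {W : normedModType R} (i : 'I_d) (u : 'rV[R]_d -> W)
    : 'rV[R]_d -> W :=
  fun x => 'D_(delta_mx ord0 i) u x.

(* The entries of the n-th derivative tensor D^n u(x) are the numbers
   [partials s u x] for s of length n. *)
Definition partials {W : normedModType R} (s : seq 'I_d) (u : 'rV[R]_d -> W)
    : 'rV[R]_d -> W :=
  foldr partial u s.

(* u is (n+1) times differentiable iff it is differentiable and its first
   partial derivatives are n times differentiable. *)
Definition smooth {W : normedModType R} (u : 'rV[R]_d -> W) : Prop :=
  forall (s : seq 'I_d) x, differentiable (partials s u) x.

Definition test_function (z : 'rV[R]_d -> R) : Prop :=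
  smooth (z : _ -> R^o) /\ compact (closure [set x | z x != 0]).

Definition locally_integrable_rV (u : 'rV[R]_d -> R) : Prop :=
  measurable_fun setT u /\
  forall K, compact K -> (lebesgue_rV R d).-integrable K (EFin \o u).

Definition is_weak_partial (i : 'I_d) (u h : 'rV[R]_d -> R) : Prop :=
  [/\ locally_integrable_rV u, locally_integrable_rV h &
   forall z, test_function z ->
     (\int[lebesgue_rV R d]_x (u x * partial i (z : _ -> R^o) x)%:E =
      - \int[lebesgue_rV R d]_x (h x * z x)%:E)%E].

End calculus.

Section potential.
Context {R : realType} {dO : measure_display} {Omega : measurableType dO}.
Variable P : probability Omega R.

(* V is an element of L^1, so its pointwise bounds are meant P-a.s. *)
Definition potential (V : Omega -> R) : Prop :=
  V \in Lfun P 1%E /\ {ae P, forall w, 0 <= V w}.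

Definition nondeterministic (V : Omega -> R) : Prop :=
  ~ exists c : R, {ae P, forall w, V w = c}.

End potential.

Record metric_dynamical_system (R : realType) (d : nat) (dO : measure_display)
    (Omega : measurableType dO) (P : probability Omega R) := MetricDS {
  mds_act :> 'rV[R]_d -> Omega -> Omega;
  mds_measurable : measurable_fun setT
    (fun p : 'rV[R]_d * Omega => mds_act p.1 p.2);
  mds_act0 : forall w, mds_act 0 w = w;
  mds_actD : forall x y w, mds_act (x + y) w = mds_act x (mds_act y w);
  mds_invariant : forall x (A : set Omega), measurable A ->
    P (mds_act x @^-1` A) = P A
}.

Section metric_dynamical_system_theory.
Context {R : realType} {d : nat} {dO : measure_display}.
Context {Omega : measurableType dO} {P : probability Omega R}.
Variable tau : metric_dynamical_system d P.

Definition realisation {T : Type} (f : Omega -> T) (w : Omega)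
    : 'rV[R]_d -> T :=
  fun x => f (tau x w).

(* D^n f (w) = D^n (f_w)(0).  Boundedness of a tensor does not depend on the
   norm chosen on the finite-dimensional space of tensors, so it is expressed
   uniformly over the entries. *)
Definition smooth_bounded {W : normedModType R} (f : Omega -> W) : Prop :=
  (forall w, smooth (realisation f w)) /\
  (forall n : nat, exists M : R, forall w (s : n.-tuple 'I_d),
     `|partials s (realisation f w) 0| <= M).

Definition gradient (f : Omega -> R) (w : Omega) : 'rV[R]_d :=
  \row_i partial i (realisation f w : _ -> R^o) 0.

Definition divergence (phi : Omega -> 'rV[R]_d) (w : Omega) : R :=
  \sum_(i < d)
    partial i (realisation (fun w' => phi w' ord0 i) w : _ -> R^o) 0.

Definition is_weak_gradient (f : Omega -> R) (g : Omega -> 'rV[R]_d) : Prop :=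
  measurable_fun setT f /\
  forall i : 'I_d,
    measurable_fun setT (fun w => g w ord0 i) /\
    {ae P, forall w, exists2 h : 'rV[R]_d -> R,
       is_weak_partial i (realisation f w) h &
       {ae lebesgue_rV R d, forall x, realisation g w x ord0 i = h x}}.

Definition classF : set (Omega -> R) :=
  [set f | [/\ f \in Lfun P 1%E, ('E_P[f] = 1)%E,
    exists2 c : R, 0 < c & forall w, c <= f w &
    smooth_bounded (f : _ -> R^o)]].

Definition classPhi (y : 'rV[R]_d) : set (Omega -> 'rV[R]_d) :=
  [set phi : Omega -> 'rV[R]_d | [/\ forall i : 'I_d, (fun w => phi w ord0 i) \in Lfun P 1%E,
    smooth_bounded phi,
    forall i : 'I_d, ('E_P[(fun w => phi w ord0 i)] = (y ord0 i)%:E)%E &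
    forall w, divergence phi w = 0]].

Local Open Scope ereal_scope.

(* Extended-real valued, since the integrals and infima are; the infima are over
   the literal classes of functions defined everywhere on Omega. *)
Definition Gamma (V : Omega -> R) (y : 'rV[R]_d) : \bar R :=
  2%:E * ereal_inf [set sqrte (
    (\int[P]_w (enorm (gradient f w) ^+ 2 / (8 * f w) + V w * f w)%:E) *
    ereal_inf [set \int[P]_w (enorm (phi w) ^+ 2 / (2 * f w))%:E
              | phi in classPhi y]) | f in classF].

End metric_dynamical_system_theory.

(* Main.v *)
Require Import Defs.
From HB Require Import structures.
From mathcomp Require Import all_boot all_order all_algebra.
From mathcomp Require Import all_classical all_reals all_analysis.
From mathcomp Require Import ess_sup_inf.
From mathcomp Require Import measurable_realfun ring lra.

(** For a constant potential c the infimum is attained at f = 1 and phi = y: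
integrating the pointwise inequality |phi|^2 / (2f) >= phi . y - f |y|^2 / 2
gives Gamma_c(y) >= 2 (c |y|^2 / 2)^(1/2).  It remains to beat this value for V
when c = E V.  Keep phi = y and take f = 1 - eps (g - E g), where g is smooth
and bounded: the two factors of Gamma_V become c - eps E[(V - c) g] + O(eps^2)
and (1 + O(eps^2)) |y|^2 / 2, so a small eps > 0 works as soon as
E[(V - c) g] > 0.  Such a g is obtained by approximating V in L^1 by smooth
functions, for then E[(V - c) g] is close to the variance of V, which is
positive.  The approximation convolves V along the flow with an approximate
identity, in one coordinate direction after the other, so that only kernels and
integrals on the real line occur. *)

Set Implicit Arguments.
Unset Strict Implicit.
Unset Printing Implicit Defensive.
Import Order.TTheory GRing.Theory Num.Theory.
Import numFieldNormedType.Exports.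

Local Open Scope classical_set_scope.
Local Open Scope ring_scope.

(** * Kernels on the real line *)

(** [classF] constrains every realisation at every point, with bounds over all of Omega, while [V]
    is controlled only almost surely and need not be smooth itself. The smoothing therefore starts
    from a truncated version of [V], bounded everywhere, and regularity is carried as a first-order
    Taylor bound with one constant for all [w]. Such a bound can be integrated against a kernel, so
    it survives smoothing in a further direction because translations commute; added up one
    coordinate at a time, it yields total differentiability. Along an orbit a bounded function need
    not be integrable on the line, so translations are compared on a bounded window only, and
    invariance of P turns this into an estimate on Omega. In the perturbation the gain is of first
    order and the losses of second order in eps: the gradient enters squared, and E(g - E g) = 0
    removes the linear term of E(1 / f). L^1 approximation of [V] is strong enough because V - c is
    bounded. *)

Section cauchy_kernel.
Context {R : realType}.
Implicit Types (f g : R -> R) (s t : R).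
Local Notation mu := (@lebesgue_measure R).

(* This algebra consists of bounded functions and is stable under derivation.
   Hence every derivative of (1 + s^2)^-1 a(s), with a in the algebra, is
   dominated by (1 + s^2)^-1; such kernels replace compactly supported bump
   functions in the mollification. *)
Inductive cauchy_algebra : (R -> R) -> Prop :=
| cauchy_cst c : cauchy_algebra (cst c)
| cauchy_inv : cauchy_algebra (fun s => (oneDsqr s)^-1)
| cauchy_id : cauchy_algebra (fun s => s * (oneDsqr s)^-1)
| cauchy_add f g : cauchy_algebra f -> cauchy_algebra g ->
    cauchy_algebra (f + g)
| cauchy_mul f g : cauchy_algebra f -> cauchy_algebra g ->
    cauchy_algebra (f * g).

Ltac cauchy_tac := repeat first [assumption | exact: cauchy_cst |
  exact: cauchy_inv | exact: cauchy_id | apply: cauchy_add | apply: cauchy_mul].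

Lemma oneDsqr_gt0 s : 0 < oneDsqr s.
Proof. by rewrite (lt_le_trans ltr01)// oneDsqr_ge1. Qed.

Lemma oneDsqr_neq0 s : oneDsqr s != 0.
Proof. by rewrite gt_eqF// oneDsqr_gt0. Qed.

Lemma is_derive_oneDsqrV s :
  is_derive s 1 (fun t => (oneDsqr t)^-1)
    (- 2 * (s * (oneDsqr s)^-1) * (oneDsqr s)^-1).
Proof.
have d1 : is_derive s 1 (@oneDsqr R) (2 * s).
  have -> : @oneDsqr R = cst 1 + id ^+ 2 by [].
  apply: is_derive_eq; rewrite add0r/= expr1 /GRing.scale/= mulr1.
  by rewrite mulr_natl.
have d2 := is_deriveV (oneDsqr_neq0 s) d1; apply: is_derive_eq.
by rewrite /GRing.scale/= -exprVn expr2; ring.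
Qed.

Lemma cauchy_algebra_derive f : cauchy_algebra f ->
  exists2 f', cauchy_algebra f' & forall s, is_derive s 1 f (f' s).
Proof.
elim=> [c|||{}f g cf [f' cf' df] cg [g' cg' dg]|{}f g cf [f' cf' df] cg [g' cg' dg]].
- by exists (cst 0) => [|s]; [exact: cauchy_cst|exact: is_derive_cst].
- exists (cst (- 2) * (fun s => s * (oneDsqr s)^-1) *
    (fun s => (oneDsqr s)^-1)); last exact: is_derive_oneDsqrV.
  by cauchy_tac.
- exists ((fun s => (oneDsqr s)^-1) + cst (- 2) *
    ((fun s => s * (oneDsqr s)^-1) * (fun s => s * (oneDsqr s)^-1))).
    by cauchy_tac.
  move=> s; have d := is_derive_oneDsqrV s.
  have -> : (fun t : R => t * (oneDsqr t)^-1) = id * (fun t => (oneDsqr t)^-1).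
    by [].
  apply: is_derive_eq; rewrite /GRing.scale/= !fctE/=; ring.
- by exists (f' + g'); [exact: cauchy_add|move=> s; exact: is_deriveD].
- exists (f * g' + g * f'); last by move=> s; exact: is_deriveM.
  by apply: cauchy_add; exact: cauchy_mul.
Qed.

Lemma cauchy_algebra_bounded f : cauchy_algebra f ->
  exists2 C : R, 0 <= C & forall s, `|f s| <= C.
Proof.
elim=> [c|||{}f g _ [C C0 hC] _ [D D0 hD]|{}f g _ [C C0 hC] _ [D D0 hD]].
- by exists `|c|.
- exists 1 => // s; rewrite ger0_norm ?invr_ge0 ?(ltW (oneDsqr_gt0 s))//.
  exact: oneDsqrV_le1.
- exists 1 => // s; rewrite normrM normfV (gtr0_norm (oneDsqr_gt0 s)).
  rewrite ler_pdivrMr ?oneDsqr_gt0// mul1r ler_norml /oneDsqr.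
  by apply/andP; split; nra.
- by exists (C + D) => [|s]; [exact: addr_ge0|exact/(le_trans (ler_normD _ _))/lerD].
- by exists (C * D) => [|s]; [exact: mulr_ge0|rewrite normrM ler_pM].
Qed.

Definition smooth_kernel f := exists2 a, cauchy_algebra a &
  f = (fun s => (oneDsqr s)^-1) * a.

(** The logarithmic derivative of (1 + s^2)^-1 is -2 s / (1 + s^2), an element of the algebra; so
    the decaying factor can be pulled out again after differentiation. *)
Lemma kernel_derive f : smooth_kernel f ->
  exists2 f', smooth_kernel f' & forall s, is_derive s 1 f (f' s).
Proof.
move=> [a ca ->]; have [a' ca' da] := cauchy_algebra_derive ca.
exists ((fun s => (oneDsqr s)^-1) *
  (a' + cst (- 2) * (fun s => s * (oneDsqr s)^-1) * a)).
  eexists; last reflexivity.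
  by cauchy_tac.
move=> s; have d := is_derive_oneDsqrV s; have := da s => ?.
by apply: is_derive_eq; rewrite /GRing.scale/= !fctE/=; ring.
Qed.

Lemma kernel_bound f : smooth_kernel f ->
  exists2 C : R, 0 <= C & forall s, `|f s| <= C * (oneDsqr s)^-1.
Proof.
move=> [a ca ->]; have [C C0 hC] := cauchy_algebra_bounded ca.
exists C => // s; rewrite normrM mulrC ler_pM//.
by rewrite ger0_norm// invr_ge0 ltW// oneDsqr_gt0.
Qed.

Lemma kernel_continuous f : smooth_kernel f -> continuous f.
Proof.
move=> /kernel_derive[f' _ df] s.
apply: differentiable_continuous; apply/derivable1_diffP.
exact: ex_derive.
Qed.

Lemma kernel_measurable f : smooth_kernel f -> measurable_fun setT f.
Proof. by move=> /kernel_continuous; exact: continuous_measurable_fun. Qed.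

Lemma kernelZ c f : smooth_kernel f -> smooth_kernel (cst c * f).
Proof.
move=> [a ca ->]; exists (cst c * a); last by rewrite mulrCA.
by cauchy_tac.
Qed.

Lemma integral_oneDsqrV : (\int[mu]_s ((oneDsqr s)^-1)%:E = pi%:E)%E.
Proof.
rewrite ge0_symfun_integralT//=.
- rewrite -set_itvcy integral0y_oneDsqr -EFinM; congr EFin.
  by rewrite mulrC divfK.
- exact: continuous_oneDsqrV.
- by move=> s /=; rewrite /oneDsqr sqrrN.
Qed.

Lemma integrable_oneDsqrV :
  mu.-integrable setT (EFin \o (fun s : R => (oneDsqr s)^-1)).
Proof.
apply/integrableP; split.
  apply/measurable_EFinP; apply: continuous_measurable_fun.
  exact: continuous_oneDsqrV.
under eq_integral => s _.
  rewrite /= ger0_norm ?invr_ge0 ?(ltW (oneDsqr_gt0 s))//.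
  over.
by rewrite integral_oneDsqrV ltry.
Qed.

Lemma integrable_kernel f : smooth_kernel f -> mu.-integrable setT (EFin \o f).
Proof.
move=> kf; have [C C0 fC] := kernel_bound kf.
apply: (@le_integrable _ _ _ mu setT _ _
  (fun s => C%:E * ((oneDsqr s)^-1)%:E)%E) => //.
- by apply/measurable_EFinP; exact: kernel_measurable.
- by move=> s _ /=; rewrite lee_fin (le_trans (fC s))// ler_norm.
- exact: integrableZl integrable_oneDsqrV.
Qed.

Lemma kernel_oneDsqrV : smooth_kernel (fun s => (oneDsqr s)^-1).
Proof.
by exists (cst 1); [constructor|apply/funext => s; rewrite !fctE/= mulr1].
Qed.

Lemma mean_value f f' (x y : R) : (forall s, is_derive s 1 f (f' s)) ->
  exists2 c, `|c - x| <= `|y - x| & f y - f x = f' c * (y - x).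
Proof.
move=> df.
have cf : continuous f.
  move=> s; apply: differentiable_continuous; apply/derivable1_diffP.
  exact: ex_derive.
have [xy|/ltW yx] := leP x y.
- have [c] := MVT_segment xy (fun s _ => df s)
    (continuous_subspaceT (A := `[x, y]) cf).
  rewrite in_itv/= => /andP[xc cy] e; exists c => //.
  by rewrite !ger0_norm ?subr_ge0// lerD2r.
- have [c] := MVT_segment yx (fun s _ => df s)
    (continuous_subspaceT (A := `[y, x]) cf).
  rewrite in_itv/= => /andP[yc cx] e; exists c.
    by rewrite !ler0_norm ?subr_le0// lerN2 lerD2r.
  by rewrite -opprB e -mulrN opprB.
Qed.

(** Two applications of the mean value theorem write the remainder as -a f''(e) (c - s) with e
    within distance 1 of s. Keeping the decay in [s] on the right makes the bound integrable over
    the line. *)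
Lemma kernel_taylor f f' : smooth_kernel f -> smooth_kernel f' ->
    (forall s, is_derive s 1 f (f' s)) ->
  exists2 C : R, 0 <= C & forall a s, `|a| <= 1 ->
    `|f (s - a) - f s + a * f' s| <= C * a ^+ 2 * (oneDsqr s)^-1.
Proof.
move=> kf kf' df; have [f2 kf2 df'] := kernel_derive kf'.
have [C C0 hC] := kernel_bound kf2; exists (3 * C); first exact: mulr_ge0.
move=> a s a1.
have [c] := mean_value s (s - a) df; rewrite addrAC subrr add0r normrN.
move=> cs ->.
have [e] := mean_value s c df' => es fe.
have -> : f' c * - a + a * f' s = - a * (f2 e * (c - s)) by rewrite -fe; ring.
rewrite !normrM normrN.
have es1 : `|e - s| <= 1 by rewrite (le_trans es)// (le_trans cs).
(* The factor 3 moves the decay from [e] to [s]: 1 + s^2 <= 3 (1 + e^2) when |e - s| <= 1, since 2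
   e^2 + 2 (e - s)^2 - s^2 = (2 e - s)^2. *)
have f2e : `|f2 e| <= 3 * C * (oneDsqr s)^-1.
  rewrite (le_trans (hC e))// mulrAC [leRHS]mulrC ler_wpM2l//.
  rewrite ler_pdivlMr ?oneDsqr_gt0// mulrC ler_pdivrMr ?oneDsqr_gt0//.
  have := sqr_ge0 (2 * e - s).
  have : (e - s) ^+ 2 <= 1 by rewrite -real_normK ?num_real ?expr_le1.
  rewrite /oneDsqr; nra.
have -> : 3 * C * a ^+ 2 * (oneDsqr s)^-1 =
    `|a| * (3 * C * (oneDsqr s)^-1 * `|a|).
  by rewrite -(real_normK (num_real a)); ring.
by do 2 (apply: ler_pM => //).
Qed.

End cauchy_kernel.

(** * Continuity of translations in L^1 *)

Section line.
Context {R : realType}.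
Local Notation mu := (@lebesgue_measure R).

Lemma cvge0P (I : (\bar R)^nat) : (forall n, 0 <= I n)%E ->
  (I @ \oo --> 0%E <->
   forall e : R, 0 < e -> \forall n \near \oo, (I n <= e%:E)%E).
Proof.
move=> I0; split=> [/fine_cvgP[If /cvgrPdist_le I_0] e e0|I_0].
  have := I_0 _ e0; apply: filter_app; near=> n.
  rewrite sub0r normrN ger0_norm ?fine_ge0// -lee_fin fineK//.
  by near: n.
apply/fine_cvgP; split.
  have := I_0 _ ltr01; apply: filterS => n In1.
  by rewrite ge0_fin_numE// (le_lt_trans In1)// ltry.
apply/cvgrPdist_le => e e0; have := I_0 _ e0; apply: filterS => n In.
rewrite sub0r normrN ger0_norm ?fine_ge0// -lee_fin fineK//.
by rewrite ge0_fin_numE// (le_lt_trans In)// ltry.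
Unshelve. all: by end_near. Qed.

Let measurable_shift (a : R) :
  measurable_fun setT (shift a : measurableTypeR R -> measurableTypeR R).
Proof. by apply: measurable_funD => //; exact: measurable_cst. Qed.

Lemma lebesgue_measure_shift (a : R) (A : set R) : measurable A ->
  pushforward mu (shift a : _ -> measurableTypeR R) A = mu A.
Proof.
have ms := measurable_shift a.
move=> mA; apply/esym/lebesgue_measure_unique => //= _ [[b c]] _ <-.
rewrite /pushforward.
have -> : shift a @^-1` `](b, c).1, (b, c).2]%classic =
    `]b - a, c - a]%classic.
  by apply/seteqP; split=> s /=; rewrite !in_itv/= ltrBlDr lerBrDr.
rewrite !lebesgue_measure_itv/= !lte_fin ltrD2r; case: ifPn => // _.
by rewrite -!EFinB; congr EFin; ring.
Qed.

Lemma ge0_integral_shift (f : R -> \bar R) (a : R) :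
  measurable_fun setT f -> (forall s, 0 <= f s)%E ->
  (\int[mu]_s f (s + a)%R = \int[mu]_s f s)%E.
Proof.
move=> mf f0; have ms := measurable_shift a.
have -> : (\int[mu]_s f (s + a)%R =
    \int[pushforward mu (shift a : _ -> measurableTypeR R)]_s f s)%E.
  by rewrite ge0_integral_pushforward//= preimage_setT.
by apply: eq_measure_integral => //= A mA _; exact: lebesgue_measure_shift.
Qed.

Lemma integral_shift (f : R -> \bar R) (a : R) : measurable_fun setT f ->
  (\int[mu]_s f (s + a)%R = \int[mu]_s f s)%E.
Proof.
move=> mf; rewrite integralE [RHS]integralE.
rewrite -(ge0_integral_shift a (measurable_funepos mf))//.
rewrite -(ge0_integral_shift a (measurable_funeneg mf))//.
by congr (_ - _)%E; apply: eq_integral => s _; rewrite !(funeposE, funenegE).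
Qed.

(** Continuous functions are dense in L^1 of a bounded interval, and for them the claim is dominated
    convergence. The statement is local because [u] will be a bounded function read along an
    orbit. *)
Lemma L1_translation_continuous (u : R -> R) (M : R) (a : R^nat) :
    measurable_fun setT u -> (forall s, `|u s| <= M) ->
    a @ \oo --> (0 : R) ->
  (\int[mu]_(s in `[0%R, 1%R]) (`|u (s + a n)%R - u s|)%:E)%E @[n --> \oo]
    --> 0%E.
Proof.
move=> mu_ uM a0.
have M0 : 0 <= M by rewrite (le_trans _ (uM 0)).
apply/cvge0P => [n|e e0].
  by apply: integral_ge0 => s _; rewrite lee_fin.
(* The window [-1, 2] contains all translates of [0, 1] by at most 1, so one approximation there
   controls both [u] and its shifts. *)
have mE : measurable (`[(- 1)%R, 2%R] : set R) by exact: measurable_itv.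
have Efin : (mu `[(- 1)%R, 2%R] < +oo)%E.
  by rewrite lebesgue_measure_itv/=; case: ifP => // _; rewrite -EFinB ltry.
have Ifin : (mu `[0%R, 1%R] < +oo)%E.
  by rewrite lebesgue_measure_itv/=; case: ifP => // _; rewrite -EFinB ltry.
have iu : mu.-integrable `[(- 1)%R, 2%R] (EFin \o u).
  apply: measurable_bounded_integrable => //; first exact: measurable_funS mu_.
  by exists M; split; [exact: num_real|move=> x Mx s _ /=; exact/(le_trans (uM s))/ltW].
have [g_ [cg _ /cvge0P gu]] := approximation_continuous_integrable mE Efin iu.
have e3 : 0 < e / 3 by rewrite divr_gt0.
have {gu}[n gn] : exists n,
    (\int[mu]_(z in `[(- 1)%R, 2%R]) (`|u z - g_ n z|)%:E <= (e / 3)%:E)%E.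
  have [|N _ /(_ N (leqnn N))] := gu _ _ e3; last by exists N.
  by move=> n; apply: integral_ge0 => s _; rewrite lee_fin.
(* Truncation gives a global bound, used as the dominating constant, and brings the approximant no
   further from [u], whose values lie in [-M, M]. *)
pose g : R -> R := (cst (- M)) \max (g_ n \min cst M).
have gM s : `|g s| <= M.
  rewrite ler_norml /g/= le_max lexx/= ge_max ge_min lexx orbT andbT.
  by rewrite (le_trans _ M0)// oppr_le0.
have cgg : continuous g.
  move=> s; apply: (@continuous_max _ _ (cst (- M)) (g_ n \min cst M)).
    exact: cvg_cst.
  by apply: (@continuous_min _ _ (g_ n) (cst M)); [exact: cg|exact: cvg_cst].
have ug s : `|u s - g s| <= `|u s - g_ n s|.
  rewrite /g/=; move: (uM s); rewrite ler_norml => /andP[u1 u2].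
  rewrite maxEle minEle; case: (leP (g_ n s) M) => h2.
    case: (leP (- M) (g_ n s)) => // h1.
    by rewrite [leLHS]ger0_norm ?[leRHS]ger0_norm; lra.
  have -> : - M <= M by lra.
  by rewrite [leLHS]ler0_norm ?[leRHS]ler0_norm; lra.
have mg : measurable_fun setT g by exact: continuous_measurable_fun.
have gg : (\int[mu]_(s in `[0%R, 1%R]) (`|g (s + a n)%R - g s|)%:E)%E
    @[n --> \oo] --> 0%E.
  have [] := @dominated_convergence _ _ _ mu `[0%R, 1%R] _
    (fun n s => (`|g (s + a n)%R - g s|)%:E) (cst 0%E) (cst (M + M)%:E).
  - exact: measurable_itv.
  - move=> k; apply/measurable_EFinP; apply: measurableT_comp => //.
    apply: measurable_funB; last exact: measurable_funS mg.
    apply: (@measurableT_comp _ _ _ _ _ _ g) => //.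
    exact: measurable_funS (measurable_shift (a k)).
  - exact: measurable_cst.
  - apply: aeW => s _; apply/fine_cvgP; split; first exact: nearW.
    rewrite -(normr0 R) -(subrr (g s)).
    apply: cvg_norm; apply: cvgB; last exact: cvg_cst.
    apply: (cvg_comp (fun n => s + a n) g); last exact: cgg.
    have : (fun n => (s : R) + a n) @ \oo --> (s : R) + 0.
      by apply: cvgD => //; exact: cvg_cst.
    by rewrite addr0.
  - apply: (@measurable_bounded_integrable _ _ _ mu (cst (M + M))) => //.
    + by exists (M + M); split => [|x Mx t _ /=]; [exact: num_real|
        rewrite ger0_norm ?addr_ge0// ltW].
  - apply: aeW => s k _; rewrite /= normr_id lee_fin.
    by rewrite (le_trans (ler_normB _ _))// lerD.
  - by move=> _ _; rewrite integral0.
have {}gg : \forall k \near \oo,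
    (\int[mu]_(s in `[0%R, 1%R]) (`|g (s + a k)%R - g s|)%:E <= (e / 3)%:E)%E.
  move/cvge0P : gg; apply=> // k.
  by apply: integral_ge0 => s _; rewrite lee_fin.
have a1 : \forall k \near \oo, `|a k| <= 1.
  by move/cvgr0Pnorm_le : a0; apply.
pose F : R -> \bar R := fun s => (`|u s - g s|)%:E.
have mF : measurable_fun setT F.
  by apply/measurable_EFinP; apply: measurableT_comp => //; exact: measurable_funB.
have F0 s : (0 <= F s)%E by rewrite lee_fin.
have mI : measurable (`[0%R, 1%R] : set R) by exact: measurable_itv.
have mFs b : measurable_fun setT (fun s : R => F (s + b)).
  by apply: (measurableT_comp mF); exact: measurable_shift.
have FE : (\int[mu]_(s in `[(- 1)%R, 2%R]) F s <= (e / 3)%:E)%E.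
  apply: le_trans gn; apply: ge0_le_integral => //.
  - exact: measurable_funS mF.
  - apply/measurable_EFinP; apply: measurableT_comp => //.
    apply: measurable_funB; first exact: measurable_funS mu_.
    by apply: measurable_funS (continuous_measurable_fun (cg n)).
  - by move=> s _; rewrite lee_fin.
have FI b : `|b| <= 1 ->
    (\int[mu]_(s in `[0%R, 1%R]) F (s + b)%R <= (e / 3)%:E)%E.
  rewrite ler_norml => /andP[b1 b2].
  apply: le_trans FE; rewrite integral_mkcond [leRHS]integral_mkcond.
  have mFr : measurable_fun setT (F \_ `[(- 1)%R, 2%R]).
    by apply/(measurable_restrictT _ _).1 => //; exact: measurable_funS mF.
  rewrite -(integral_shift b mFr); apply: ge0_le_integral => //.
  - by move=> s _; apply: erestrict_ge0 => ? _; rewrite lee_fin.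
  - apply/(measurable_restrictT _ _).1 => //; exact: measurable_funS (mFs b).
  - by apply: (measurableT_comp mFr); exact: measurable_shift.
  - move=> s _; rewrite !patchE; case: ifPn => [|_].
      rewrite inE/= in_itv/= => /andP[s0 s1].
      by rewrite mem_set//= in_itv/=; apply/andP; split; lra.
    by case: ifPn => // _; rewrite lee_fin.
near=> k.
have mgs : measurable_fun setT (fun s : R => (`|g (s + a k) - g s|)%:E).
  apply/measurable_EFinP; apply: measurableT_comp => //.
  apply: measurable_funB => //; apply: (measurableT_comp mg).
  exact: measurable_shift.
have ak : `|a k| <= 1 by near: k.
apply: (@le_trans _ _ (\int[mu]_(s in `[0%R, 1%R])
    (F (s + a k)%R + ((`|g (s + a k) - g s|)%:E + F s)))%E).
  apply: ge0_le_integral => //.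
  - apply/measurable_EFinP; apply: measurableT_comp => //.
    apply: measurable_funB; last exact: measurable_funS mu_.
    apply: (@measurableT_comp _ _ _ _ _ _ u) => //.
    exact: measurable_funS (measurable_shift (a k)).
  - apply: emeasurable_funD; first exact: measurable_funS (mFs (a k)).
    by apply: emeasurable_funD; [exact: measurable_funS mgs|exact: measurable_funS mF].
  - move=> s _; rewrite -!EFinD lee_fin.
    rewrite (_ : u _ - u s = (u (s + a k) - g (s + a k)) +
      ((g (s + a k) - g s) - (u s - g s))); last by ring.
    by rewrite (le_trans (ler_normD _ _))// lerD// ler_normB.
rewrite ge0_integralD; [|exact: mI|by []|exact: measurable_funS (mFs (a k))
  |by move=> s _; rewrite adde_ge0|]; last first.
  by apply: emeasurable_funD; [exact: measurable_funS mgs|exact: measurable_funS mF].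
rewrite ge0_integralD; [|exact: mI|by move=> s _; rewrite lee_fin
  |exact: measurable_funS mgs|by []|exact: measurable_funS mF].
have -> : e = e / 3 + (e / 3 + e / 3) by field.
rewrite !EFinD; apply: leeD; first exact: FI.
apply: leeD; first by near: k.
apply: le_trans (FI 0 _); last by rewrite normr0.
rewrite le_eqVlt; apply/orP; left; apply/eqP; apply: eq_integral => s _.
by rewrite (addr0 (s : R)).
Unshelve. all: by end_near. Qed.
End line.

Lemma ge0_dominated_cvg0 d (T : measurableType d) (R : realType)
    (mu : {measure set T -> \bar R}) (D : set T) (f : (T -> \bar R)^nat)
    (g : T -> \bar R) :
    measurable D -> (forall n, measurable_fun D (f n)) ->
    (forall n x, D x -> 0 <= f n x <= g x)%E -> mu.-integrable D g ->
    (forall x, D x -> f n x @[n --> \oo] --> 0%E) ->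
  (\int[mu]_(x in D) f n x)%E @[n --> \oo] --> 0%E.
Proof.
move=> mD mf fg ig f0.
have [] := @dominated_convergence _ _ _ mu D mD f (cst 0%E) g mf.
- exact: measurable_cst.
- exact: aeW.
- exact: ig.
- by apply: aeW => x n Dx; have /andP[fx ?] := fg n x Dx; rewrite gee0_abs.
- by move=> _ _; rewrite integral0.
Qed.

Lemma bounded_integrable d (T : measurableType d) (R : realType)
    (P : probability T R) (f : T -> R) (M : R) :
  measurable_fun setT f -> (forall x, `|f x| <= M) ->
  P.-integrable setT (EFin \o f).
Proof.
move=> mf fM; apply: measurable_bounded_integrable => //.
  by rewrite (le_lt_trans (probability_le1 P measurableT))// ltry.
by exists M; split => [|x Mx t _]; [exact: num_real|exact/(le_trans (fM t))/ltW].
Qed.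

Lemma integrable_bounded_mul d (T : measurableType d) (R : realType)
    (mu : {measure set T -> \bar R}) (b f : T -> R) (M : R) :
    measurable_fun setT b -> (forall x, `|b x| <= M) ->
    mu.-integrable setT (EFin \o f) ->
  mu.-integrable setT (EFin \o (fun x => b x * f x)).
Proof.
move=> mb bM /[dup] /measurable_int/measurable_EFinP mf intf.
apply: (@le_integrable _ _ _ mu setT _ _ (fun x => M%:E * (f x)%:E)%E) => //.
- by apply/measurable_EFinP; exact: measurable_funM.
- move=> x _ /=; rewrite lee_fin !normrM ler_wpM2r//.
  by rewrite (le_trans (bM x))// ler_norm.
- exact: integrableZl.
Qed.

Lemma normr_Rintegral_mul_le d (T : measurableType d) (R : realType)
    (mu : {measure set T -> \bar R}) (b f g : T -> R) (M : R) :
    measurable_fun setT b -> (forall x, `|b x| <= M) -> 0 <= M ->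
    mu.-integrable setT (EFin \o f) -> mu.-integrable setT (EFin \o g) ->
    (forall x, `|f x| <= g x) ->
  `|\int[mu]_x (b x * f x)| <= M * \int[mu]_x g x.
Proof.
move=> mb bM M0 intf intg fg.
have ibf := integrable_bounded_mul mb bM intf.
apply: (le_trans (le_normr_Rintegral _ ibf)) => //.
rewrite -RintegralZl//; apply: le_Rintegral => //.
- exact: integrable_norm ibf.
- exact: integrableZl intg.
- by move=> x _; rewrite normrM ler_pM.
Qed.

(** * Mollification along a measure-preserving flow *)

Section flow.
Context {R : realType} {dO : measure_display} {Omega : measurableType dO}.
Variables (P : probability Omega R) (theta : R -> Omega -> Omega).
Hypothesis mtheta : measurable_fun setT (fun p : R * Omega => theta p.1 p.2).
Hypothesis thetaD : forall s t w, theta (s + t) w = theta s (theta t w).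
Hypothesis theta_inv : forall s A, measurable A -> P (theta s @^-1` A) = P A.
Local Notation mu := (@lebesgue_measure R).

Lemma measurable_flow s : measurable_fun setT (theta s).
Proof. exact: measurableT_comp mtheta (pair1_measurable s). Qed.

Lemma measurable_orbit w : measurable_fun setT (theta^~ w).
Proof. exact: measurableT_comp mtheta (pair2_measurable w). Qed.

Lemma ge0_integral_flow s (f : Omega -> \bar R) : measurable_fun setT f ->
  (forall w, 0 <= f w)%E -> (\int[P]_w f (theta s w) = \int[P]_w f w)%E.
Proof.
move=> mf f0; have ms := measurable_flow s.
have -> : (\int[P]_w f (theta s w) = \int[pushforward P (theta s)]_w f w)%E.
  by rewrite ge0_integral_pushforward//= preimage_setT.
by apply: eq_measure_integral => //= A mA _; exact: theta_inv.
Qed.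

(* By invariance the integral equals its average over the time shifts of
   [0, 1], and Fubini reduces the claim to translations of the orbits. *)
Lemma flow_L1_continuous (h : Omega -> R) (M : R) (a : R^nat) :
    measurable_fun setT h -> (forall w, `|h w| <= M) ->
    a @ \oo --> (0 : R) ->
  (\int[P]_w (`|h (theta (a n) w) - h w|)%:E)%E @[n --> \oo] --> 0%E.
Proof.
move=> mh hM a0.
have M0 : 0 <= M by rewrite (le_trans _ (hM point)).
have mhp : measurable_fun setT (fun p : R * Omega => h (theta p.1 p.2)).
  exact: measurableT_comp.
pose I : set R := `[0%R, 1%R]%classic.
have mI : measurable I by exact: measurable_itv.
have muI : mu I = 1%E.
  by rewrite /I lebesgue_measure_itv/= lte_fin ltr01 oppr0 adde0.
have mF n : measurable_fun setT (fun p : Omega * R =>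
    (`|h (theta (p.2 + a n) p.1) - h (theta p.2 p.1)| * \1_I p.2)%:E).
  apply/measurable_EFinP; apply: measurable_funM; last first.
    by apply: measurableT_comp => //; exact: measurable_indic.
  apply: measurableT_comp => //; apply: measurable_funB.
    have m1 : measurable_fun setT (fun p : Omega * R => (p.2 + a n, p.1)).
      by apply: measurable_fun_pair => //; exact: measurable_funD.
    exact: measurableT_comp mhp m1.
  have m1 : measurable_fun setT (fun p : Omega * R => (p.2, p.1)).
    exact: measurable_fun_pair.
  exact: measurableT_comp mhp m1.
have F0 n (p : Omega * R) : (0 <=
    (`|h (theta (p.2 + a n) p.1) - h (theta p.2 p.1)| * \1_I p.2)%:E)%E.
  by rewrite lee_fin mulr_ge0.
have E w n : (\int[mu]_s
     (`|h (theta (s + a n) w) - h (theta s w)| * \1_I s)%:E =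
   \int[mu]_(s in I) (`|h (theta (s + a n)%R w) - h (theta s w)|)%:E)%E.
  rewrite [RHS]integral_mkcond; apply: eq_integral => s _.
  by rewrite patchE indicE; case: ifPn => _; rewrite ?mulr1 ?mulr0.
have key n : (\int[P]_w (`|h (theta (a n) w) - h w|)%:E =
    \int[P]_w \int[mu]_(s in I)
      (`|h (theta (s + a n)%R w) - h (theta s w)|)%:E)%E.
  under [RHS]eq_integral do rewrite -E.
  have swap := fubini_tonelli (m1 := P) (m2 := mu) _ (mF n) (F0 n).
  apply: etrans (esym swap); rewrite /=.
  transitivity (\int[mu]_(s in I) \int[P]_w (`|h (theta (a n) w) - h w|)%:E)%E.
    by rewrite [RHS]integral_cst// -[LHS]mule1; congr (_ * _)%E; exact: esym muI.
  rewrite [LHS]integral_mkcond; apply: eq_integral => s _.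
  rewrite patchE indicE; case: ifPn => _; last first.
    by under eq_integral do rewrite mulr0; rewrite integral0.
  rewrite -(ge0_integral_flow s).
  - by apply: eq_integral => w _; rewrite mulr1 -thetaD (addrC (a n)).
  - apply/measurable_EFinP; apply: measurableT_comp => //.
    apply: measurable_funB => //.
    by apply: measurableT_comp => //; exact: measurable_flow.
  - by move=> w; rewrite lee_fin.
under eq_fun do rewrite key.
apply: (@ge0_dominated_cvg0 _ _ _ _ _ _ (cst (M + M)%:E)) => //.
- move=> n; under eq_fun do rewrite -E.
  exact: (measurable_fun_fubini_tonelli_F (m2 := mu) _ (mF n) (F0 n)).
- move=> n w _; apply/andP; split.
    by apply: integral_ge0 => s _; rewrite lee_fin.
  rewrite /= -[leRHS]mule1 -muI -integral_cst//.
  apply: ge0_le_integral => //.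
  - apply/measurable_EFinP/measurable_funTS; apply: measurableT_comp => //.
    have mo := measurable_orbit w.
    apply: measurable_funB; last exact: measurableT_comp.
    have ms : measurable_fun setT (fun s : R => s + a n) by exact: measurable_funD.
    exact: measurableT_comp mh (measurableT_comp mo ms).
  - by move=> s _; rewrite lee_fin (le_trans (ler_normB _ _))// lerD.
- apply: (@bounded_integrable _ _ _ _ (cst (M + M)) (M + M)) => // w.
  by rewrite /= ger0_norm// addr_ge0.
- move=> w _; apply: L1_translation_continuous a0; last by move=> s; exact: hM.
  by apply: measurableT_comp => //; exact: measurable_orbit.
Qed.
(** With this sign convention, advancing [w] by time [a] replaces the kernel by [eta (s - a)]; the
    derivative along the flow is thus the smoothing with kernel [- eta']. *)
Definition smoothing (eta : R -> R) (k : Omega -> R) (w : Omega) : R :=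
  \int[mu]_s (k (theta s w) * eta s).

Lemma measurable_along_orbit (k : Omega -> R) w : measurable_fun setT k ->
  measurable_fun setT (fun s => k (theta s w)).
Proof. by move=> mk; apply: (measurableT_comp mk); exact: measurable_orbit. Qed.

(** The integrand is signed, so measurability in [w] comes from Fubini; integrability on the product
    follows from |k| <= M, eta in L^1 and P having mass 1. *)
Lemma measurable_smoothing (eta : R -> R) (k : Omega -> R) (M : R) :
    smooth_kernel eta -> measurable_fun setT k -> (forall w, `|k w| <= M) ->
  measurable_fun setT (smoothing eta k).
Proof.
move=> keta mk kM; have M0 : 0 <= M by rewrite (le_trans _ (kM point)).
have meta := kernel_measurable keta.
have mf : measurable_fun setT
    (fun p : Omega * R => (k (theta p.2 p.1) * eta p.2)%:E).
  apply/measurable_EFinP; apply: measurable_funM; last exact: measurableT_comp.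
  have m1 : measurable_fun setT (fun p : Omega * R => (p.2, p.1)).
    exact: measurable_fun_pair.
  have m2 : measurable_fun setT (fun p : R * Omega => k (theta p.1 p.2)).
    exact: measurableT_comp.
  exact: measurableT_comp m2 m1.
have intf : (P \x mu)%E.-integrable setT
    (fun p : Omega * R => (k (theta p.2 p.1) * eta p.2)%:E).
  apply/(integrable12ltyP P mu mf).
  pose A := (\int[mu]_s `|(eta s)%:E|)%E.
  have Aoo : (A < +oo)%E by have /integrableP[] := integrable_kernel keta.
  apply: (@le_lt_trans _ _ (\int[P]_w (M%:E * A))%E).
    apply: ge0_le_integral => //.
    - by move=> w _; exact: integral_ge0.
    - exact: (measurable_fun_fubini_tonelli_F (m2 := mu) (abse \o _)
        (measurableT_comp _ mf) (fun=> abse_ge0 _)).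
    - move=> w _ /=; rewrite /A.
      rewrite -(@ge0_integralZl _ _ _ mu _ measurableT (abse \o (EFin \o eta)))//.
      + apply: ge0_le_integral => //.
        * apply/measurable_EFinP; apply: measurableT_comp => //.
          by apply: measurable_funM => //; exact: measurable_along_orbit.
        * apply/measurable_EFinP; apply: measurable_funM => //.
          exact: measurableT_comp.
        * by move=> s _; rewrite /= normrM lee_fin ler_wpM2r.
      + by apply/measurable_EFinP; exact: measurableT_comp.
      + by move=> s _; exact: abse_ge0.
  rewrite integral_cst// (le_lt_trans (lee_wpmul2l _ (probability_le1 P measurableT)))//.
    by rewrite mule_ge0// integral_ge0.
  by rewrite mule1 lte_mul_pinfty.
have := measurable_fubini_F intf.
by move=> mF; apply: measurableT_comp mF.
Qed.

Lemma smoothing_bounded (eta : R -> R) (k : Omega -> R) (M : R) :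
    smooth_kernel eta -> measurable_fun setT k -> (forall w, `|k w| <= M) ->
  exists C : R, forall w, `|smoothing eta k w| <= C.
Proof.
move=> keta mk kM; have M0 : 0 <= M by rewrite (le_trans _ (kM point)).
exists (M * \int[mu]_s `|eta s|) => w.
apply: normr_Rintegral_mul_le => //.
- exact: measurable_along_orbit.
- exact: integrable_kernel.
- by apply: integrable_norm; exact: integrable_kernel.
Qed.

Lemma smoothing_shift (eta : R -> R) (k : Omega -> R) (a : R) w :
    smooth_kernel eta -> measurable_fun setT k ->
  smoothing eta k (theta a w) = \int[mu]_s (k (theta s w) * eta (s - a)).
Proof.
move=> keta mk; have meta := kernel_measurable keta.
rewrite /smoothing /Rintegral; congr fine.
rewrite -[RHS](integral_shift a).
  by apply: eq_integral => s _; rewrite thetaD addrK.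
apply/measurable_EFinP; apply: measurable_funM.
  exact: measurable_along_orbit.
by apply: (measurableT_comp meta); exact: measurable_funB.
Qed.

(** All differentiation falls on the kernel: the bound of [kernel_taylor] is integrated against the
    bounded factor [k (theta s w)], which makes the constant independent of [w]. *)
Lemma smoothing_taylor (eta eta' : R -> R) (k : Omega -> R) (M : R) :
    smooth_kernel eta -> smooth_kernel eta' ->
    (forall s : R, is_derive s 1 eta (eta' s)) ->
    measurable_fun setT k -> (forall w, `|k w| <= M) ->
  exists C : R, forall a w, `|a| <= 1 ->
    `|smoothing eta k (theta a w) - smoothing eta k w
      + a * smoothing eta' k w| <= C * a ^+ 2.
Proof.
move=> keta keta' deta mk kM.
have M0 : 0 <= M by rewrite (le_trans _ (kM point)).
have [C C0 hC] := kernel_taylor keta keta' deta.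
exists (M * (C * \int[mu]_s (oneDsqr s)^-1)) => a w a1.
have mkw := measurable_along_orbit w mk.
have ik f : mu.-integrable setT (EFin \o f) ->
    mu.-integrable setT (EFin \o (fun s => k (theta s w) * f s)).
  by apply: integrable_bounded_mul => // s; exact: kM.
have ieta := integrable_kernel keta; have ieta' := integrable_kernel keta'.
have ietaa : mu.-integrable setT (EFin \o (fun s => eta (s - a))).
  apply/integrableP; split.
    apply/measurable_EFinP; apply: (measurableT_comp (kernel_measurable keta)).
    exact: measurable_funB.
  have /integrableP[m] := ieta; rewrite -(integral_shift (- a)) => [//|].
  exact: measurableT_comp.
have ietaB : mu.-integrable setT (EFin \o (fun s : R => eta (s - a) - eta s)).
  exact: (integrableB measurableT ietaa ieta).
have -> : smoothing eta k (theta a w) - smoothing eta k w +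
    a * smoothing eta' k w =
    \int[mu]_s (k (theta s w) * (eta (s - a) - eta s + a * eta' s)).
  rewrite smoothing_shift// /smoothing -RintegralZl//; last exact: ik.
  rewrite -RintegralB//; [|exact: ik|exact: ik].
  rewrite -RintegralD//.
  - by apply: eq_Rintegral => s _; ring.
  - rewrite (_ : _ \o _ = EFin \o (fun s => k (theta s w) * (eta (s - a) - eta s))).
      exact: ik.
    by apply/funext => s /=; rewrite mulrBr.
  - exact: (integrableZl measurableT a (ik _ ieta')).
have ir : mu.-integrable setT (EFin \o (fun s => C * a ^+ 2 * (oneDsqr s)^-1)).
  exact: (integrableZl measurableT _ integrable_oneDsqrV).
have -> : M * (C * \int[mu]_s (oneDsqr s)^-1) * a ^+ 2 =
    M * \int[mu]_s (C * a ^+ 2 * (oneDsqr s)^-1).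
  by rewrite RintegralZl//; [ring|exact: integrable_oneDsqrV].
apply: normr_Rintegral_mul_le => //; last by move=> s; exact: hC.
exact: (integrableD measurableT ietaB (integrableZl measurableT a ieta')).
Qed.
End flow.

(** * Approximate identities along the flow *)

Section mollification.
Context {R : realType} {dO : measure_display} {Omega : measurableType dO}.
Variables (P : probability Omega R) (theta : R -> Omega -> Omega).
Hypothesis mtheta : measurable_fun setT (fun p : R * Omega => theta p.1 p.2).
Hypothesis thetaD : forall s t w, theta (s + t) w = theta s (theta t w).
Hypothesis theta_inv : forall s A, measurable A -> P (theta s @^-1` A) = P A.
Local Notation mu := (@lebesgue_measure R).

Lemma measurable_rescaled_flow (delta : R) :
  measurable_fun setT (fun p : R * Omega => theta (delta * p.1) p.2).
Proof.
have m1 : measurable_fun setT (fun p : R * Omega => (delta * p.1, p.2)).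
  by apply: measurable_fun_pair => //; exact: measurable_funM.
exact: measurableT_comp mtheta m1.
Qed.

(** Slowing the flow down by [delta] has the effect of concentrating the kernel, while [eta] stays
    fixed. By Tonelli the L^1 error is at most the integral over s of eta(s) times the L^1 distance
    between [h] and its shift by delta s; this tends to 0 by [flow_L1_continuous], dominated by 2 M
    eta(s). *)
Lemma mollification_L1 (eta : R -> R) (h : Omega -> R) (M e : R) :
    smooth_kernel eta -> (forall s, 0 <= eta s) ->
    (\int[mu]_s (eta s)%:E = 1)%E ->
    measurable_fun setT h -> (forall w, `|h w| <= M) -> 0 < e ->
  exists2 delta : R, 0 < delta &
    (\int[P]_w (`|smoothing (fun s => theta (delta * s)) eta h w - h w|)%:E
     <= e%:E)%E.
Proof.
move=> keta eta0 eta1 mh hM e0.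
have M0 : 0 <= M by rewrite (le_trans _ (hM point)).
have meta := kernel_measurable keta; have ieta := integrable_kernel keta.
pose F (n : nat) (p : Omega * R) : \bar R :=
  (`|h (theta (n.+1%:R^-1 * p.2) p.1) - h p.1| * eta p.2)%:E.
have mtn (n : nat) := measurable_rescaled_flow n.+1%:R^-1.
have mF n : measurable_fun setT (F n).
  apply/measurable_EFinP; apply: measurable_funM; last exact: measurableT_comp.
  apply: measurableT_comp => //; apply: measurable_funB; last first.
    exact: measurableT_comp.
  have m1 : measurable_fun setT (fun p : Omega * R => (p.2, p.1)).
    exact: measurable_fun_pair.
  exact: (measurableT_comp mh (measurableT_comp (mtn n) m1)).
have F0 n p : (0 <= F n p)%E by rewrite lee_fin mulr_ge0.
have cF : (\int[P]_w \int[mu]_s F n (w, s))%E @[n --> \oo] --> 0%E.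
  have -> : (fun n => \int[P]_w \int[mu]_s F n (w, s))%E =
      (fun n => \int[mu]_s \int[P]_w F n (w, s))%E.
    by apply/funext => n; exact: (fubini_tonelli (m1 := P) (m2 := mu) _ (mF n) (F0 n)).
  have FE n s : (\int[P]_w F n (w, s) =
      (eta s)%:E * \int[P]_w (`|h (theta (n.+1%:R^-1 * s) w) - h w|)%:E)%E.
    rewrite -ge0_integralZl//; last by rewrite lee_fin.
      by apply: eq_integral => w _; rewrite /F/= -EFinM mulrC.
    apply/measurable_EFinP; apply: measurableT_comp => //.
    apply: measurable_funB => //; apply: measurableT_comp => //.
    exact: measurable_flow.
  apply: (@ge0_dominated_cvg0 _ _ _ mu setT
    (fun n s => \int[P]_w F n (w, s))%E (fun s => (M + M)%:E * (eta s)%:E)%E) => //.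
  - move=> n.
    exact: (measurable_fun_fubini_tonelli_G (m1 := P) _ (mF n) (F0 n)).
  - move=> n s _; apply/andP; split; first exact: integral_ge0.
    rewrite FE muleC; apply: lee_wpmul2r; first by rewrite lee_fin.
    rewrite -[leRHS]mule1 -(@probability_setT _ _ _ P) -integral_cst//.
    apply: ge0_le_integral => //.
    + apply/measurable_EFinP; apply: measurableT_comp => //.
      apply: measurable_funB => //; apply: measurableT_comp => //.
      exact: measurable_flow.
    + by move=> w _; rewrite lee_fin (le_trans (ler_normB _ _))// lerD.
  - exact: integrableZl.
  - move=> s _; under eq_fun do rewrite FE.
    rewrite -(mule0 (eta s)%:E); apply: cvgeZl => //.
    apply: (@flow_L1_continuous _ _ _ P theta _ _ _ h M) => //.
    rewrite -(mul0r (s : R)); apply: cvgMl.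
    exact: cvg_harmonic.
have [n Fn] : exists n, (\int[P]_w \int[mu]_s F n (w, s) <= e%:E)%E.
  have IF0 n : (0 <= \int[P]_w \int[mu]_s F n (w, s))%E.
    by apply: integral_ge0 => w _; exact: integral_ge0.
  have [N _ /(_ N (leqnn N)) FN] := (cvge0P IF0).1 cF e e0; by exists N.
exists n.+1%:R^-1 => //; apply: le_trans Fn; apply: ge0_le_integral => //.
- apply/measurable_EFinP; apply: measurableT_comp => //.
  apply: measurable_funB => //.
  exact: (measurable_smoothing P (mtn n) keta mh hM).
- exact: (measurable_fun_fubini_tonelli_F (m2 := mu) _ (mF n) (F0 n)).
move=> w _.
have mhw : measurable_fun setT (fun s : R => h (theta (n.+1%:R^-1 * s) w)).
  exact: (measurable_along_orbit (theta := fun s : R => theta (n.+1%:R^-1 * s)) (mtn n) w mh).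
have ih : mu.-integrable setT (EFin \o (fun s : R => h (theta (n.+1%:R^-1 * s) w) * eta s)).
  by apply: integrable_bounded_mul ieta => // s; exact: hM.
have ihB : mu.-integrable setT
    (EFin \o (fun s : R => (h (theta (n.+1%:R^-1 * s) w) - h w) * eta s)).
  apply: (@integrable_bounded_mul _ _ _ mu
    (fun s : R => h (theta (n.+1%:R^-1 * s) w) - h w) eta (M + M)) => //.
    exact: measurable_funB.
  by move=> s; rewrite (le_trans (ler_normB _ _))// lerD.
have -> : smoothing (fun s : R => theta (n.+1%:R^-1 * s)) eta h w - h w =
    \int[mu]_s ((h (theta (n.+1%:R^-1 * s) w) - h w) * eta s).
  have eta1R : \int[mu]_s eta s = 1 by rewrite /Rintegral eta1.
  rewrite -[X in _ - X]mulr1 -[X in _ - _ * X]eta1R.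
  rewrite -RintegralZl// -RintegralB//; last exact: (integrableZl measurableT _ ieta).
  by apply: eq_Rintegral => s _; rewrite mulrBl.
rewrite EFin_normr_Rintegral//.
apply: (le_trans (le_abse_integral _ measurableT (measurable_int _ ihB))).
rewrite le_eqVlt; apply/orP; left; apply/eqP; apply: eq_integral => s _.
by rewrite /F/= normrM (ger0_norm (eta0 s)).
Qed.

(** The witness is the density of the standard Cauchy law. *)
Lemma exists_unit_kernel : exists eta : R -> R, [/\ smooth_kernel eta,
  forall s, 0 <= eta s & (\int[mu]_s (eta s)%:E = 1)%E].
Proof.
exists (cst pi^-1 * (fun s => (oneDsqr s)^-1)); split.
- by apply: kernelZ; exact: kernel_oneDsqrV.
- by move=> s; rewrite mulr_ge0// ?invr_ge0 ?pi_ge0// ltW// oneDsqr_gt0.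
- under eq_integral do rewrite /= EFinM.
  rewrite integralZl//; last exact: integrable_oneDsqrV.
  by rewrite integral_oneDsqrV -EFinM mulVf// gt_eqF// pi_gt0.
Qed.
End mollification.

(** * Functions that are smooth along the action *)

Section quadratic_remainder.
Context {R : realType} {d : nat}.

Lemma le_coord_mx_norm (x : 'rV[R]_d) (i : 'I_d) : `|x ord0 i| <= `|x|.
Proof.
rewrite [leRHS]mx_normrE.
exact: (le_bigmax _ (fun ij : 'I_1 * 'I_d => `|x ij.1 ij.2|) (ord0, i)).
Qed.

(** The candidate differential with gradient [c], given a linear structure so that uniqueness of the
    differential can be applied to it. *)
Definition row_pairing (c x : 'rV[R]_d) : R^o := \sum_(i < d) x ord0 i * c ord0 i.

Lemma row_pairing_is_linear c : linear (row_pairing c).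
Proof.
move=> a x y; rewrite /row_pairing scaler_sumr -big_split/=.
by apply: eq_bigr => i _; rewrite !mxE mulrDl scalerAl.
Qed.

HB.instance Definition _ c :=
  GRing.isLinear.Build R _ _ _ (row_pairing c) (row_pairing_is_linear c).

Lemma row_pairing_continuous c : continuous (row_pairing c).
Proof.
rewrite (_ : row_pairing c = \sum_(i < d) (fun x => x ord0 i * c ord0 i : R^o)).
  elim/big_ind: _ => [|f g cf cg|i _] x.
  - exact: (@cst_continuous _ _ (0 : R^o) x).
  - exact: (continuousD (cf x) (cg x)).
  - apply: (@continuousM R _ (fun y : 'rV[R]_d => y ord0 i) (cst (c ord0 i))).
      exact: coord_continuous.
    exact: cst_continuous.
by apply/funext => x; rewrite fct_sumE.
Qed.

(** A quadratic remainder is o(h), so [row_pairing c] is the differential, and its values on the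
    basis vectors are the partial derivatives. *)
Lemma quadratic_remainder_differentiable (u : 'rV[R]_d -> R) (x c : 'rV[R]_d)
    (C : R) :
    (forall h, `|u (h + x) - u x - row_pairing c h| <= C * `|h| ^+ 2) ->
  differentiable (u : _ -> R^o) x /\
  forall i, partial i (u : _ -> R^o) x = c ord0 i.
Proof.
move=> uC.
have ux : (u : _ -> R^o) \o shift x = cst (u x) + row_pairing c +o_ (0 : 'rV[R]_d) id.
  apply/eqaddoP => e e0; near=> h.
  rewrite /= !fctE/= opprD addrA (le_trans (uC h))// expr2 mulrA ler_wpM2r//.
  have : `|h| <= e / (`|C| + 1).
    near: h; apply: (@nbhs0_le R 'rV[R]_d (e / (`|C| + 1))).
    by rewrite divr_gt0// ltr_wpDl.
  rewrite ler_pdivlMr ?ltr_wpDl// => hC.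
  rewrite (le_trans _ hC)// mulrC ler_wpM2l// (le_trans (ler_norm C))//.
  by rewrite lerDl.
have du : 'd (u : _ -> R^o) x = row_pairing c :> (_ -> _).
  by apply: diff_unique ux; exact: row_pairing_continuous.
have dx : differentiable (u : _ -> R^o) x.
  by apply/diff_locallyP; rewrite du; split => //; exact: row_pairing_continuous.
split => // i; rewrite /partial deriveE// du /row_pairing.
rewrite (bigD1 i)//= big1 ?addr0 ?mxE ?eqxx ?mul1r// => j ji.
by rewrite mxE (negbTE ji) andbF mul0r.
Unshelve. all: by end_near. Qed.

End quadratic_remainder.

Section smooth_classes.
Context {R : realType} {d : nat} {dO : measure_display}.
Context {Omega : measurableType dO} {P : probability Omega R}.
Variable tau : metric_dynamical_system d P.
Implicit Types (g h k : Omega -> R) (A : set (Omega -> R)) (J : seq 'I_d).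

Definition has_partial (i : 'I_d) g g' := exists C : R, forall t w,
  `|g (tau (t *: delta_mx ord0 i) w) - g w - t * g' w| <= C * t ^+ 2.

(* A set of functions stable under the partial derivatives in the directions
   J, where the first order Taylor remainder is quadratic uniformly in w.  This
   uniformity survives mollification in a further direction. *)
Record smooth_class J A : Prop := SmoothClass {
  smooth_class_measurable : forall g, A g -> measurable_fun setT g;
  smooth_class_bounded : forall g, A g -> exists M : R, forall w, `|g w| <= M;
  smooth_class_partial : forall g i, A g -> i \in J ->
    exists2 g', A g' & has_partial i g g'
}.

Lemma bounded_has_partial i g g' (M M' C rho : R) : 0 < rho ->
  (forall w, `|g w| <= M) -> (forall w, `|g' w| <= M') ->
  (forall t w, `|t| <= rho ->
     `|g (tau (t *: delta_mx ord0 i) w) - g w - t * g' w| <= C * t ^+ 2) ->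
  has_partial i g g'.
Proof.
move=> rho0 gM gM' gC.
have M0 : 0 <= M by rewrite (le_trans _ (gM point)).
have M'0 : 0 <= M' by rewrite (le_trans _ (gM' point)).
(* For |t| > rho the trivial bound 2 M + |t| M' suffices, since 1 < t^2 / rho^2 and |t| < t^2 /
   rho. *)
exists (`|C| + (2 * M / rho ^+ 2 + M' / rho)) => t w; rewrite mulrDl.
have [trho|rhot] := leP `|t| rho.
  rewrite (le_trans (gC _ _ trho))// -[leLHS]addr0 lerD//.
    by rewrite ler_wpM2r ?sqr_ge0// ler_norm.
  by rewrite mulr_ge0 ?sqr_ge0// addr_ge0// divr_ge0 ?mulr_ge0 ?sqr_ge0// ltW.
rewrite -[leLHS]add0r lerD ?(mulr_ge0 (normr_ge0 C) (sqr_ge0 t))//.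
rewrite (le_trans (ler_normB _ _))// mulrDl lerD//.
  rewrite (@le_trans _ _ (2 * M))//.
    rewrite (le_trans (ler_normB _ _))// mulr_natl mulr2n.
    exact: lerD (gM _) (gM _).
  rewrite -mulrA ler_peMr ?mulr_ge0// mulrC ler_pdivlMr ?exprn_gt0// mul1r.
  by rewrite -(real_normK (num_real t)) lerXn2r// ?nnegrE// ltW.
rewrite normrM mulrC -mulrA ler_pM//.
rewrite -(real_normK (num_real t)) expr2 mulrA ler_peMl//.
by rewrite mulrC ler_pdivlMr// mul1r ltW.
Qed.

Section step.
Variables (J : seq 'I_d) (A : set (Omega -> R)) (i : 'I_d) (delta : R).
Hypotheses (cA : smooth_class J A) (delta0 : 0 < delta).

Let theta (s : R) : Omega -> Omega := tau ((delta * s) *: delta_mx ord0 i).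

Let thetaD s t w : theta (s + t) w = theta s (theta t w).
Proof. by rewrite /theta -mds_actD -scalerDl -mulrDr. Qed.

Lemma measurable_direction_flow (v : 'rV[R]_d) :
  measurable_fun setT (fun p : R * Omega => tau (p.1 *: v) p.2).
Proof.
have m1 : measurable_fun setT (fun p : R * Omega => (p.1 *: v, p.2)).
  apply: measurable_fun_pair => //; apply/measurable_fun_rVP => j.
  rewrite (_ : _ \o _ = (fun p => p.1 * v ord0 j)); first exact: measurable_funM.
  by apply/funext => p; rewrite /rV_coord/= mxE.
exact: measurableT_comp (mds_measurable tau) m1.
Qed.

Let mtheta : measurable_fun setT (fun p : R * Omega => theta p.1 p.2).
Proof.
exact: (measurable_rescaled_flow (theta := fun s => tau (s *: delta_mx ord0 i))
  (measurable_direction_flow _)).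
Qed.

Definition smoothing_class : set (Omega -> R) :=
  [set f | exists eta g, [/\ smooth_kernel eta, A g &
    f = smoothing (fun s => tau ((delta * s) *: delta_mx ord0 i)) eta g]].

(** In direction [i] the derivative passes to the kernel and asks nothing of [g]. In another
    direction of [J] it passes to [g], because the action is commutative and the remainder bound,
    uniform in [w], can be integrated against |eta|. *)
Lemma smoothing_class_smooth : smooth_class (i :: J) smoothing_class.
Proof.
split.
- move=> _ [eta [g [keta Ag ->]]]; have [M gM] := smooth_class_bounded cA Ag.
  exact: (measurable_smoothing P mtheta keta (smooth_class_measurable cA Ag) gM).
- move=> _ [eta [g [keta Ag ->]]]; have [M gM] := smooth_class_bounded cA Ag.
  exact: (smoothing_bounded mtheta keta (smooth_class_measurable cA Ag) gM).
- move=> _ j [eta [g [keta Ag ->]]]; rewrite inE => ij.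
  have [M gM] := smooth_class_bounded cA Ag.
  have mg := smooth_class_measurable cA Ag.
  have [eqij|neqij] := eqVneq j i.
    have [eta' keta' deta] := kernel_derive keta.
    (* A displacement [t] is the flow time [t / delta], whence the factor 1 / delta; the sign comes
       from the shift [eta (s - a)]. *)
    have kc := kernelZ (- delta^-1) keta'.
    exists (smoothing theta (cst (- delta^-1) * eta') g).
      by exists (cst (- delta^-1) * eta'), g; split.
    have [M1 hM1] := smoothing_bounded mtheta keta mg gM.
    have [M2 hM2] := smoothing_bounded mtheta kc mg gM.
    have [C hC] := smoothing_taylor mtheta thetaD keta keta' deta mg gM.
    (* The kernel estimate holds for flow times up to 1, that is for displacements up to [delta]. *)
    apply: (@bounded_has_partial _ _ _ M1 M2 (C / delta ^+ 2) delta) => // t w tdelta.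
    have td : `|t / delta| <= 1.
      by rewrite normrM normfV (gtr0_norm delta0) ler_pdivrMr// mul1r.
    have := hC (t / delta) w td.
    have -> : smoothing theta (cst (- delta^-1) * eta') g w =
        - delta^-1 * smoothing theta eta' g w.
      rewrite /smoothing -RintegralZl//.
        by apply: eq_Rintegral => s _; rewrite /= mulrCA.
      apply: integrable_bounded_mul (integrable_kernel keta').
        exact: (measurable_along_orbit mtheta w mg).
      by move=> s; exact: gM.
    have -> : theta (t / delta) w = tau (t *: delta_mx ord0 j) w.
      by rewrite /theta (mulrC delta) divfK ?gt_eqF// eqij.
    move=> h.
    rewrite (_ : C / delta ^+ 2 * t ^+ 2 = C * (t / delta) ^+ 2); last first.
      by rewrite expr_div_n; ring.
    apply: le_trans h; rewrite le_eqVlt; apply/orP; left; apply/eqP; congr (`| _ |).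
    by rewrite mulNr mulrN opprK mulrA.
  have {neqij}ij : j \in J by move: ij; rewrite (negbTE neqij).
  have [g' Ag' [C gg']] := smooth_class_partial cA Ag ij.
  exists (smoothing theta eta g'); first by exists eta, g'; split.
  exists (C * \int[@lebesgue_measure R]_s `|eta s|) => t w.
  have [M' gM'] := smooth_class_bounded cA Ag'.
  have mg' := smooth_class_measurable cA Ag'.
  have ieta := integrable_kernel keta.
  have C0 : 0 <= C.
    by have := gg' 1 point; rewrite expr1n mulr1; apply: le_trans.
  have mgo := measurable_along_orbit mtheta w mg.
  have mgo' := measurable_along_orbit mtheta w mg'.
  have mgto : measurable_fun setT
      (fun s => g (tau (t *: delta_mx ord0 j) (theta s w))).
    apply: (measurable_along_orbit mtheta w (k := g \o tau (t *: delta_mx ord0 j))).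
    by apply: measurableT_comp => //; exact: (measurable_flow
      (theta := fun s => tau (s *: delta_mx ord0 j)) (measurable_direction_flow _) t).
  have i1 : (@lebesgue_measure R).-integrable setT
      (EFin \o (fun s : R => g (theta s w) * eta s)).
    by apply: integrable_bounded_mul ieta => // s; exact: gM.
  have i2 : (@lebesgue_measure R).-integrable setT
      (EFin \o (fun s : R => g (tau (t *: delta_mx ord0 j) (theta s w)) * eta s)).
    by apply: integrable_bounded_mul ieta => // s; exact: gM.
  have i3 : (@lebesgue_measure R).-integrable setT
      (EFin \o (fun s : R => g' (theta s w) * eta s)).
    by apply: integrable_bounded_mul ieta => // s; exact: gM'.
  have -> : smoothing theta eta g (tau (t *: delta_mx ord0 j) w)
      - smoothing theta eta g w - t * smoothing theta eta g' w =
    \int[@lebesgue_measure R]_s ((g (tau (t *: delta_mx ord0 j) (theta s w)) -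
       g (theta s w) - t * g' (theta s w)) * eta s).
    rewrite {1}/smoothing (_ : (fun s => g (theta s (tau _ w)) * eta s) =
        (fun s => g (tau (t *: delta_mx ord0 j) (theta s w)) * eta s)); last first.
      by apply/funext => s; rewrite /theta -!mds_actD addrC.
    rewrite -RintegralZl// -RintegralB// -RintegralB//.
    - by apply: eq_Rintegral => s _; ring.
    - exact: (integrableB measurableT i2 i1).
    - exact: (integrableZl measurableT t i3).
  rewrite mulrAC; apply: normr_Rintegral_mul_le => //.
  - apply: measurable_funB; first exact: measurable_funB.
    exact: measurable_funM.
  - by rewrite mulr_ge0// sqr_ge0.
  - exact: integrable_norm ieta.
Qed.
End step.
End smooth_classes.

(** * Density of smooth classes, and total differentiability of their members *)

Section smooth_class_theory.
Context {R : realType} {d : nat} {dO : measure_display}.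
Context {Omega : measurableType dO} {P : probability Omega R}.
Variable tau : metric_dynamical_system d P.
Implicit Types (g h k : Omega -> R) (A : set (Omega -> R)) (J : seq 'I_d).

(** Induction on the list of directions. The empty list imposes no derivatives, so all bounded
    measurable functions form a class and [h] approximates itself; each new direction costs one more
    smoothing and half of the error. *)
Lemma smooth_class_dense J h (M e : R) :
    measurable_fun setT h -> (forall w, `|h w| <= M) -> 0 < e ->
  exists A g, [/\ smooth_class tau J A, A g &
    (\int[P]_w (`|g w - h w|)%:E <= e%:E)%E].
Proof.
move=> mh hM; elim: J e => [|i J IH] e e0.
  exists [set f : Omega -> R | measurable_fun setT f /\
    exists M : R, forall w, `|f w| <= M].
  exists h; split; last 2 first.
  - by split => //; exists M.
  - by under eq_integral do rewrite subrr normr0; rewrite integral0 lee_fin ltW.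
  by split => [g []|g []|].
have e20 : 0 < e / 2 by rewrite divr_gt0.
have [A [g [cA Ag gh]]] := IH _ e20.
have [eta [keta eta0 eta1]] := @exists_unit_kernel R.
have mg := smooth_class_measurable cA Ag.
have [M' gM'] := smooth_class_bounded cA Ag.
have mflow := measurable_direction_flow tau (delta_mx ord0 i).
have [||delta delta0 gdelta] :=
    @mollification_L1 _ _ _ P (fun s => tau (s *: delta_mx ord0 i)) mflow _ _
      eta g M' _ keta eta0 eta1 mg gM' e20.
- by move=> s t w; rewrite scalerDl mds_actD.
- by move=> s B mB; exact: mds_invariant.
exists (smoothing_class tau A i delta).
pose f := smoothing (fun s => tau ((delta * s) *: delta_mx ord0 i)) eta g.
have cf := smoothing_class_smooth i cA delta0.
have Af : smoothing_class tau A i delta f by exists eta, g; split.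
have mf := smooth_class_measurable cf Af.
exists f; split => //.
have mgh : measurable_fun setT (fun w => (`|g w - h w|)%:E).
  apply/measurable_EFinP; apply: measurableT_comp => //; exact: measurable_funB.
have mfg : measurable_fun setT (fun w => (`|f w - g w|)%:E).
  apply/measurable_EFinP; apply: measurableT_comp => //; exact: measurable_funB.
have -> : e = e / 2 + e / 2 by field.
rewrite EFinD; apply: le_trans (leeD gdelta gh).
rewrite -ge0_integralD//; [|by move=> w _; rewrite lee_fin..].
apply: ge0_le_integral => //.
- apply/measurable_EFinP; apply: measurableT_comp => //; exact: measurable_funB.
- exact: emeasurable_funD.
- move=> w _; rewrite -EFinD lee_fin.
  by rewrite (_ : f w - h w = (f w - g w) + (g w - h w)) ?ler_normD//; ring.
Qed.

(** Serves the competitor 1 - eps (g - E g), which is affine in [g]. A fixed slope with a free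
    constant is stable under derivation: the derivative of c + b g is 0 + b g'. *)
Lemma smooth_class_affine J A (b : R) : smooth_class tau J A ->
  smooth_class tau J
    [set f | exists2 g, A g & exists c, f = (fun w => c + b * g w)].
Proof.
move=> cA; split.
- move=> _ [g Ag [c ->]]; apply: measurable_funD => //; apply: measurable_funM => //.
  exact: smooth_class_measurable cA _ Ag.
- move=> _ [g Ag [c ->]]; have [M gM] := smooth_class_bounded cA Ag.
  exists (`|c| + `|b| * M) => w; rewrite (le_trans (ler_normD _ _))// lerD//.
  by rewrite normrM ler_wpM2l.
- move=> _ i [g Ag [c ->]] iJ.
  have [g' Ag' [C gg']] := smooth_class_partial cA Ag iJ.
  exists (fun w => 0 + b * g' w); first by exists g' => //; exists 0.
  exists (`|b| * C) => t w.
  rewrite (_ : _ - _ - _ = b * (g (tau (t *: delta_mx ord0 i) w) - g w - t * g' w)).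
    by rewrite normrM -mulrA ler_wpM2l.
  by ring.
Qed.

Section full.
Variable A : set (Omega -> R).
Hypothesis cA : smooth_class tau (enum 'I_d) A.

Let partialA g i : A g -> exists2 g', A g' & has_partial tau i g g'.
Proof. by move=> Ag; apply: (smooth_class_partial cA Ag); rewrite mem_enum. Qed.

Lemma has_partial_lipschitz g g' i (M M' : R) : has_partial tau i g g' ->
  (forall w, `|g w| <= M) -> (forall w, `|g' w| <= M') ->
  exists L : R, forall t w, `|g (tau (t *: delta_mx ord0 i) w) - g w| <= L * `|t|.
Proof.
move=> [C gC] gM gM'.
have M0 : 0 <= M by rewrite (le_trans _ (gM point)).
have M'0 : 0 <= M' by rewrite (le_trans _ (gM' point)).
have C0 : 0 <= C.
  by have := gC 1 point; rewrite expr1n mulr1; apply: le_trans.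
exists (C + M' + 2 * M) => t w.
have [t1|t1] := leP `|t| 1.
  apply: (@le_trans _ _ (C * `|t| + M' * `|t|)).
    rewrite -(subrK (t * g' w) (_ - _)) (le_trans (ler_normD _ _))// lerD//.
      rewrite (le_trans (gC t w))// ler_wpM2l// -(real_normK (num_real t)) expr2.
      exact: ler_piMl.
    by rewrite normrM mulrC ler_wpM2r.
  by rewrite -mulrDl ler_wpM2r// lerDl mulr_ge0.
rewrite (@le_trans _ _ (2 * M))//.
  by rewrite (le_trans (ler_normB _ _))// mulr_natl mulr2n lerD.
rewrite -[leLHS]mulr1 ler_pM// ?mulr_ge0//; last exact: ltW.
by rewrite lerDr addr_ge0.
Qed.

(** Summing over a list allows induction: a point of R^d is reached by moving along one coordinate
    at a time. *)
Let pt (l : seq 'I_d) (a : 'I_d -> R) : 'rV[R]_d :=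
  \sum_(i <- l) a i *: delta_mx ord0 i.

Lemma smooth_class_lipschitz g (l : seq 'I_d) : A g ->
  exists L : R, forall a r w, (forall i, `|a i| <= r) ->
    `|g (tau (pt l a) w) - g w| <= L * r.
Proof.
move=> Ag; elim: l => [|i l [L gL]].
  exists 0 => a r w ar; rewrite /pt big_nil mds_act0 subrr normr0 mul0r//.
have [g' Ag' gg'] := partialA i Ag.
have [M gM] := smooth_class_bounded cA Ag.
have [M' gM'] := smooth_class_bounded cA Ag'.
have [L' gL'] := has_partial_lipschitz gg' gM gM'.
have L'0 : 0 <= L'.
  by have := gL' 1 point; rewrite normr1 mulr1; apply: le_trans.
exists (L' + L) => a r w ar; rewrite /pt big_cons mds_actD mulrDl.
rewrite -(subrK (g (tau (pt l a) w)) (g _)) -addrA (le_trans (ler_normD _ _))//.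
by rewrite lerD ?gL// (le_trans (gL' _ _))// ler_wpM2l.
Qed.

(** Each coordinate move has its own quadratic remainder, but its linear term is evaluated at the
    intermediate point [tau (pt l a) w]. Bringing it back to [w] costs |a_i| times the Lipschitz
    bound for [D i], again of order r^2. *)
Lemma smooth_class_taylor g (D : 'I_d -> Omega -> R) (l : seq 'I_d) : A g ->
    (forall i, A (D i) /\ has_partial tau i g (D i)) ->
  exists C : R, forall a r w, (forall i, `|a i| <= r) ->
    `|g (tau (pt l a) w) - g w - \sum_(i <- l) a i * D i w| <= C * r ^+ 2.
Proof.
move=> Ag gD; elim: l => [|i l [C gC]].
  exists 0 => a r w ar.
  by rewrite /pt !big_nil mds_act0 subrr subr0 normr0 mul0r.
have [ADi [K gK]] := gD i.
have [L DL] := smooth_class_lipschitz l ADi.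
have K0 : 0 <= K.
  by have := gK 1 point; rewrite expr1n mulr1; apply: le_trans.
exists (K + L + C) => a r w ar; rewrite /pt !big_cons mds_actD -/(pt l a).
set w' := tau (pt l a) w; set S := \sum_(_ <- _) _.
rewrite (_ : _ - _ - _ = (g (tau (a i *: delta_mx ord0 i) w') - g w' - a i * D i w') +
   a i * (D i w' - D i w) + (g w' - g w - S)); last by ring.
rewrite !mulrDl (le_trans (ler_normD _ _))// lerD//; last exact: gC.
rewrite (le_trans (ler_normD _ _))// lerD//.
  rewrite (le_trans (gK _ _))// ler_wpM2l// -(real_normK (num_real (a i))).
  by rewrite lerXn2r// nnegrE// (le_trans _ (ar i)).
rewrite normrM expr2 mulrCA ler_pM// ?DL//.
Qed.

Lemma smooth_class_differentiable g : A g ->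
  exists2 D : 'I_d -> Omega -> R, forall i, A (D i) &
  forall w x, differentiable (realisation tau g w : _ -> R^o) x /\
    forall i, partial i (realisation tau g w : _ -> R^o) x =
      realisation tau (D i) w x.
Proof.
move=> Ag.
have /choice[D gD] : forall i, exists g', A g' /\ has_partial tau i g g'.
  by move=> i; have [g' ? ?] := partialA i Ag; exists g'.
exists D => [i|w x]; first by have [] := gD i.
have [C gC] := smooth_class_taylor (index_enum 'I_d) Ag gD.
have := @quadratic_remainder_differentiable R d (realisation tau g w) x
  (\row_i D i (tau x w)) C.
case=> [y|dx px]; last first.
  by split => // i; rewrite px mxE.
(* The norm on row vectors is the sup norm, hence an admissible radius for the coordinates; the base
   point [x] is absorbed by starting from [tau x w]. *)
have := gC (fun i => y ord0 i) `|y| (tau x w) (le_coord_mx_norm y).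
rewrite /pt -row_sum_delta -mds_actD /row_pairing.
by under [in X in _ -> X]eq_bigr do rewrite mxE.
Qed.

Lemma smooth_class_partials g (s : seq 'I_d) : A g ->
  exists2 g', A g' & forall w,
    partials s (realisation tau g w : _ -> R^o) = realisation tau g' w.
Proof.
move=> Ag; elim: s => [|i s [g' Ag' IH]]; first by exists g.
have [D AD gD] := smooth_class_differentiable Ag'.
exists (D i) => // w; rewrite /= IH; apply/funext => x.
by have [_ ->] := gD w x.
Qed.

Lemma smooth_class_smooth_bounded g : A g -> smooth_bounded tau (g : _ -> R^o).
Proof.
move=> Ag; split => [w s x|n].
  have [g' Ag' ->] := smooth_class_partials s Ag.
  by have [D _ /(_ w x)[]] := smooth_class_differentiable Ag'.
have /choice[M gM] : forall s : n.-tuple 'I_d, exists M : R, forall w,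
    `|partials s (realisation tau g w : _ -> R^o) 0| <= M.
  move=> s; have [g' Ag' E] := smooth_class_partials s Ag.
  have [M gM] := smooth_class_bounded cA Ag'.
  by exists M => w; rewrite E; exact: gM.
(* There are finitely many tuples and each [M s] bounds a norm, so the sum of these nonnegative
   numbers dominates each of them. *)
exists (\sum_(s : n.-tuple 'I_d) M s) => w s.
rewrite (le_trans (gM s w))// (bigD1 s)//= lerDl sumr_ge0// => t _.
exact: le_trans (gM t point).
Qed.

Lemma smooth_class_gradient g : A g -> exists2 D : 'I_d -> Omega -> R,
  forall i, A (D i) & forall w i, gradient tau g w ord0 i = D i w.
Proof.
move=> Ag; have [D AD gD] := smooth_class_differentiable Ag.
exists D => // w i; have [_ px] := gD w 0.
by rewrite /gradient mxE px /realisation mds_act0.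
Qed.

End full.
End smooth_class_theory.

(** * The variational argument *)

(* No measurability is assumed: the integrands of [Gamma] contain gradients and
   quotients whose measurability is thus never needed. *)
Lemma le_ge0_integral d (T : measurableType d) (R : realType)
    (mu : {measure set T -> \bar R}) (f g : T -> \bar R) :
  (forall x, 0 <= f x)%E -> (forall x, f x <= g x)%E ->
  (\int[mu]_x f x <= \int[mu]_x g x)%E.
Proof.
move=> f0 fg; rewrite !ge0_integralTE//; last first.
  by move=> x; exact: le_trans (f0 x) (fg x).
apply: le_ereal_sup => _ [h hf <-]; exists h => // x.
exact: le_trans (hf x) (fg x).
Qed.

(** The integral of [f] is that of its positive part minus a nonnegative quantity; dropping the
    latter leaves a comparison of nonnegative functions, to which [le_ge0_integral] applies. *)
Lemma le_integral_funepos d (T : measurableType d) (R : realType)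
    (mu : {measure set T -> \bar R}) (f g : T -> \bar R) :
  (forall x, f x <= g x)%E -> (\int[mu]_x f x <= \int[mu]_x g^\+ x)%E.
Proof.
move=> fg; rewrite integralE -[leRHS]sube0; apply: leeB.
  by apply: le_ge0_integral => // x; apply: (@funepos_le _ _ setT) => //; rewrite inE.
exact: integral_ge0.
Qed.

(** * Expectations of bounded measurable functions *)

Section bounded_measurable.
Context {R : realType} {dO : measure_display} {Omega : measurableType dO}.
Variable P : probability Omega R.
Implicit Types (f g : Omega -> R).

Definition bounded_measurable f :=
  measurable_fun setT f /\ exists M : R, forall w, `|f w| <= M.

Lemma bounded_measurable_cst c : bounded_measurable (fun=> c).
Proof. by split => //; exists `|c|. Qed.

Lemma bounded_measurableD f g : bounded_measurable f -> bounded_measurable g ->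
  bounded_measurable (fun w => f w + g w).
Proof.
move=> [mf [M fM]] [mg [N gN]]; split; first exact: measurable_funD.
by exists (M + N) => w; rewrite (le_trans (ler_normD _ _))// lerD.
Qed.

Lemma bounded_measurableM f g : bounded_measurable f -> bounded_measurable g ->
  bounded_measurable (fun w => f w * g w).
Proof.
move=> [mf [M fM]] [mg [N gN]]; split; first exact: measurable_funM.
by exists (M * N) => w; rewrite normrM ler_pM.
Qed.

Lemma bounded_measurableZ c f : bounded_measurable f ->
  bounded_measurable (fun w => c * f w).
Proof. by move=> bf; exact: bounded_measurableM (bounded_measurable_cst c) bf. Qed.

Lemma bounded_measurableN f : bounded_measurable f ->
  bounded_measurable (fun w => - f w).
Proof.
move=> [mf [M fM]]; split; first exact: measurableT_comp.
by exists M => w; rewrite normrN.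
Qed.

Lemma bounded_measurableB f g : bounded_measurable f -> bounded_measurable g ->
  bounded_measurable (fun w => f w - g w).
Proof. by move=> bf /bounded_measurableN; exact: bounded_measurableD. Qed.

Lemma bounded_measurable_integrable f : bounded_measurable f ->
  P.-integrable setT (EFin \o f).
Proof. by move=> [mf [M fM]]; exact: bounded_integrable fM. Qed.

Lemma EFin_mean f : bounded_measurable f ->
  (\int[P]_w (f w)%:E = (\int[P]_w f w)%:E)%E.
Proof.
move=> /bounded_measurable_integrable intf.
by rewrite /Rintegral fineK//; exact: integrable_fin_num.
Qed.

Lemma mean_cst c : \int[P]_w c = c.
Proof.
rewrite Rintegral_cst// -[RHS]mulr1; congr (_ * _).
have -> // : 1 = fine 1%E :> R by [].
by congr fine; exact: probability_setT.
Qed.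

Lemma meanD f g : bounded_measurable f -> bounded_measurable g ->
  \int[P]_w (f w + g w) = \int[P]_w f w + \int[P]_w g w.
Proof.
by move=> bf bg; rewrite RintegralD//; exact: bounded_measurable_integrable.
Qed.

Lemma meanB f g : bounded_measurable f -> bounded_measurable g ->
  \int[P]_w (f w - g w) = \int[P]_w f w - \int[P]_w g w.
Proof.
by move=> bf bg; rewrite RintegralB//; exact: bounded_measurable_integrable.
Qed.

Lemma meanZ c f : bounded_measurable f ->
  \int[P]_w (c * f w) = c * \int[P]_w f w.
Proof. by move=> bf; rewrite RintegralZl//; exact: bounded_measurable_integrable. Qed.

Lemma le_mean f g : bounded_measurable f -> bounded_measurable g ->
  (forall w, f w <= g w) -> \int[P]_w f w <= \int[P]_w g w.
Proof.
by move=> bf bg fg; apply: le_Rintegral => //; exact: bounded_measurable_integrable.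
Qed.

Lemma normr_mean_le f (M : R) : bounded_measurable f -> (forall w, `|f w| <= M) ->
  `|\int[P]_w f w| <= M.
Proof.
move=> bf fM; rewrite ler_norml -(mean_cst M) -(mean_cst (- _)).
have cb := bounded_measurable_cst.
apply/andP; split; apply: le_mean => // w; have := fM w; rewrite ler_norml.
  by rewrite mean_cst => /andP[].
by move=> /andP[].
Qed.

End bounded_measurable.

(** * Lower bound for constant potentials *)

Section lower_bound.
Context {R : realType} {d : nat} {dO : measure_display}.
Context {Omega : measurableType dO} {P : probability Omega R}.
Variable tau : metric_dynamical_system d P.

Lemma enorm_sqr (v : 'rV[R]_d) : enorm v ^+ 2 = \sum_(i < d) v ord0 i ^+ 2.
Proof. by rewrite sqr_sqrtr// sumr_ge0// => i _; exact: sqr_ge0. Qed.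

Lemma enorm_sqr_gt0 (v : 'rV[R]_d) : v <> 0 -> 0 < enorm v ^+ 2.
Proof.
move=> v0; rewrite lt0r sqr_ge0 andbT enorm_sqr.
apply/eqP => /eqP; rewrite psumr_eq0; last by move=> i _; exact: sqr_ge0.
move=> /allP v20; apply: v0; apply/rowP => i; rewrite mxE; apply/eqP.
by rewrite -sqrf_eq0; apply: v20; rewrite mem_index_enum.
Qed.

(* Expand |u - a v|^2 >= 0. *)
Lemma young_row (u v : 'rV[R]_d) (a : R) : 0 < a ->
  \sum_(i < d) v ord0 i * u ord0 i - enorm v ^+ 2 / 2 * a
  <= enorm u ^+ 2 / (2 * a).
Proof.
move=> a0; have a20 : 0 < 2 * a by rewrite mulr_gt0.
rewrite ler_pdivlMr// !enorm_sqr -subr_ge0.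
suff -> : \sum_(i < d) u ord0 i ^+ 2 - (\sum_(i < d) v ord0 i * u ord0 i -
    (\sum_(i < d) v ord0 i ^+ 2) / 2 * a) * (2 * a) =
    \sum_(i < d) (u ord0 i - a * v ord0 i) ^+ 2.
  by apply: sumr_ge0 => i _; exact: sqr_ge0.
rewrite mulrBl [_ / 2 * a * _](_ : _ =
  a ^+ 2 * \sum_(i < d) v ord0 i ^+ 2); last by field.
rewrite mulr_suml mulr_sumr opprB addrA addrC addrA -sumrN -!big_split/=.
by apply: eq_bigr => i _; ring.
Qed.

Lemma integral_enorm_div_ge (f : Omega -> R) phi (y : 'rV[R]_d) :
  classF tau f -> classPhi tau y phi ->
  ((enorm y ^+ 2 / 2)%:E <= \int[P]_w (enorm (phi w) ^+ 2 / (2 * f w))%:E)%E.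
Proof.
move=> [/Lfun1_integrable If Ef [a a0 fa] _] [Iphi _ Ephi _].
have f0 w : 0 < f w by exact: lt_le_trans (fa w).
pose H w := \sum_(i < d) y ord0 i * phi w ord0 i - enorm y ^+ 2 / 2 * f w.
have Iphi' i : P.-integrable setT (fun w => (y ord0 i)%:E * (phi w ord0 i)%:E)%E.
  by apply: integrableZl => //; apply/Lfun1_integrable.
have Isum : P.-integrable setT
    (fun w => (\sum_(i < d) (y ord0 i)%:E * (phi w ord0 i)%:E)%E).
  by apply: integrable_sum => // i _.
have IfN : P.-integrable setT (fun w => (enorm y ^+ 2 / 2)%:E * (f w)%:E)%E.
  exact: integrableZl If.
have HE w : (H w)%:E = ((\sum_(i < d) (y ord0 i)%:E * (phi w ord0 i)%:E) -
    (enorm y ^+ 2 / 2)%:E * (f w)%:E)%E.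
  by rewrite EFinB sumEFin EFinM.
have -> : ((enorm y ^+ 2 / 2)%:E = \int[P]_w (H w)%:E)%E.
  under eq_integral do rewrite HE.
  rewrite integralB// integralZl// integral_sum//.
  move: Ef; rewrite unlock => ->.
  under eq_bigr => i _.
    rewrite integralZl//; last by apply/Lfun1_integrable.
    have := Ephi i; rewrite unlock => ->; rewrite -EFinM -expr2.
    over.
  by rewrite sumEFin -enorm_sqr mule1 -EFinB; congr EFin; field.
(* [H] can be negative, but the integrand on the right is nonnegative and so dominates the positive
   part of [H] as well. *)
apply: (le_trans (@le_integral_funepos _ _ _ _ _ (fun w => (H w)%:E) _)) => //.
apply: le_ge0_integral => // w; rewrite funeposE ge_max !lee_fin young_row//=.
by rewrite divr_ge0// ?sqr_ge0// mulr_ge0// ltW.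
Qed.

(** Each factor is bounded below uniformly in [f]: dropping the gradient term leaves c E f = c, and
    [integral_enorm_div_ge] handles every admissible [phi]. *)
Lemma Gamma_cst_ge (c : R) (y : 'rV[R]_d) : 0 <= c ->
  (2%:E * sqrte (c * (enorm y ^+ 2 / 2))%:E <= Gamma tau (fun=> c) y)%E.
Proof.
move=> c0; apply: lee_wpmul2l; first by rewrite lee_fin.
apply/ereal_infP => _ [f Ff <-].
have [/Lfun1_integrable If Ef [a a0 fa] _] := Ff.
have f0 w : 0 < f w by exact: lt_le_trans (fa w).
rewrite EFinM lee_sqrt; last first.
  apply: mule_ge0.
    apply: integral_ge0 => w _; rewrite lee_fin addr_ge0//.
      by rewrite divr_ge0// ?sqr_ge0// mulr_ge0// ltW.
    by rewrite mulr_ge0// ltW.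
  apply/ereal_infP => _ [phi _ <-]; apply: integral_ge0 => w _.
  by rewrite lee_fin divr_ge0// ?sqr_ge0// mulr_ge0// ltW.
apply: lee_pmul; rewrite ?lee_fin ?divr_ge0 ?sqr_ge0//.
  have -> : (c%:E = \int[P]_w (c * f w)%:E)%E.
    under eq_integral do rewrite EFinM.
    by rewrite integralZl//; move: Ef; rewrite unlock => ->; rewrite mule1.
  apply: le_ge0_integral => w; rewrite lee_fin; first by rewrite mulr_ge0// ltW.
  by rewrite lerDr divr_ge0// ?sqr_ge0// mulr_ge0// ltW.
by apply/ereal_infP => _ [phi Phi <-]; exact: integral_enorm_div_ge.
Qed.

End lower_bound.

(** * Upper bound from a test function and a constant field *)

Section upper_bound.
Context {R : realType} {d : nat} {dO : measure_display}.
Context {Omega : measurableType dO} {P : probability Omega R}.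
Variable tau : metric_dynamical_system d P.

Lemma classPhi_cst (y : 'rV[R]_d) : classPhi tau y (fun=> y).
Proof.
have Ec (W : normedModType R) (v : W) (s : seq 'I_d) :
    exists v' : W, partials s (cst v : 'rV[R]_d -> W) = cst v'.
  elim: s => [|i s [v' E]]; first by exists v.
  by exists 0; rewrite /= E; apply/funext => x; rewrite /partial derive_cst.
split.
- move=> i; apply/Lfun1_integrable.
  exact: (bounded_measurable_integrable P (bounded_measurable_cst _)).
- split=> [w s x|n].
    have [v' E] := Ec _ y s; rewrite (_ : realisation _ _ _ = cst y)// E.
    exact: differentiable_cst.
  exists (\sum_(s : n.-tuple 'I_d) `|partials s (cst y : 'rV[R]_d -> 'rV[R]_d) 0|).
  move=> w s; rewrite (bigD1 s)//= (_ : realisation _ _ _ = cst y)//.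
  by rewrite lerDl sumr_ge0.
- by move=> i; rewrite (expectation_cst P (y ord0 i)).
- move=> w; rewrite /divergence big1// => i _.
  by rewrite /partial (_ : realisation _ _ _ = cst (y ord0 i))// derive_cst.
Qed.

Lemma Gamma_le (V : Omega -> R) (y : 'rV[R]_d) (f : Omega -> R) (a b : R) :
  classF tau f -> 0 <= a ->
  (\int[P]_w (enorm (gradient tau f w) ^+ 2 / (8 * f w) + V w * f w)%:E <= a%:E)%E ->
  (\int[P]_w (enorm y ^+ 2 / (2 * f w))%:E <= b%:E)%E ->
  (Gamma tau V y <= 2%:E * sqrte (a * b)%:E)%E.
Proof.
move=> Ff a0 fa fb.
have [_ _ [e e0 fe] _] := Ff.
have f0 w : 0 < f w by exact: lt_le_trans (fe w).
apply: lee_wpmul2l; first by rewrite lee_fin.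
set I := fun f => ereal_inf [set (\int[P]_w (enorm (phi w) ^+ 2 / (2 * f w))%:E)%E
  | phi in classPhi tau y].
have I0 : (0 <= I f)%E.
  apply/ereal_infP => _ [phi _ <-]; apply: integral_ge0 => w _.
  by rewrite lee_fin divr_ge0// ?sqr_ge0// mulr_ge0// ltW.
have Ib : (I f <= b%:E)%E.
  apply: le_trans fb; apply: ereal_inf_lbound; exists (fun=> y) => //.
  exact: classPhi_cst.
apply: (@le_trans _ _ (sqrte
  ((\int[P]_w (enorm (gradient tau f w) ^+ 2 / (8 * f w) + V w * f w)%:E) * I f)%E)).
  by apply: ereal_inf_lbound; exists f.
rewrite lee_sqrt; last by rewrite lee_fin mulr_ge0// -lee_fin (le_trans I0).
rewrite EFinM (le_trans (lee_wpmul2r I0 fa))//.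
by apply: lee_wpmul2l => //; rewrite lee_fin.
Qed.

End upper_bound.

(** * Perturbation of the constant function 1 *)

Section perturbation.
Context {R : realType} {d : nat} {dO : measure_display}.
Context {Omega : measurableType dO} {P : probability Omega R}.
Variable tau : metric_dynamical_system d P.

Lemma smooth_class_bounded_measurable J (A : set (Omega -> R)) g :
  smooth_class tau J A -> A g -> bounded_measurable g.
Proof.
move=> cA Ag; split; first exact: smooth_class_measurable cA _ Ag.
exact: smooth_class_bounded cA _ Ag.
Qed.

Lemma gradient_affine (A : set (Omega -> R)) (a b : R) g w :
  smooth_class tau (enum 'I_d) A -> A g ->
  gradient tau (fun w => a + b * g w) w = b *: gradient tau g w.
Proof.
move=> cA Ag; apply/rowP => i; rewrite !mxE.
have [D _ /(_ w 0)[dg _]] := smooth_class_differentiable cA Ag.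
have dgi := derivableP (diff_derivable dg : derivable _ _ (delta_mx ord0 i)).
rewrite /partial.
rewrite (_ : realisation tau (fun w => a + b * g w) w =
  cst (a : R^o) + b \*: (realisation tau g w : _ -> R^o))//.
by rewrite derive_val add0r.
Qed.

Lemma exists_smooth_correlated (V : Omega -> R) (c : R) :
  bounded_measurable V -> c = \int[P]_w V w ->
  0 < \int[P]_w ((V w - c) ^+ 2) ->
  exists A g, [/\ smooth_class tau (enum 'I_d) A, A g &
    0 < \int[P]_w ((V w - c) * g w)].
Proof.
move=> bV cE; set sigma := \int[P]_w _ => sigma0.
have bc := bounded_measurable_cst (Omega := Omega) c.
have bW := bounded_measurableB bV bc.
have [mV [M VM]] := bV; have [mW [K WK]] := bW.
have K0 : 0 <= K by rewrite (le_trans _ (WK point)).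
(* [K] bounds |V - c|, so replacing [V] by [g] changes E((V - c) V) = sigma by at most [K] times
   this tolerance, which is less than sigma. Using [K + 1] keeps the divisor positive. *)
have e0 : 0 < sigma / (2 * (K + 1)) by rewrite divr_gt0// mulr_gt0// ltr_wpDl.
have [A [g [cA Ag gV]]] := smooth_class_dense tau (enum 'I_d) mV VM e0.
have bg := smooth_class_bounded_measurable cA Ag.
have bVg : bounded_measurable (fun w => `|g w - V w|).
  have [mD [N DN]] := bounded_measurableB bg bV; split; first exact: measurableT_comp.
  by exists N => w; rewrite normr_id.
exists A, g; split => //.
have WV : \int[P]_w ((V w - c) * V w) = sigma.
  transitivity (\int[P]_w ((V w - c) ^+ 2 + c * (V w - c))).
    by apply: eq_Rintegral => w _; ring.
  rewrite meanD; [|by under eq_fun do rewrite expr2; exact: bounded_measurableM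
    |exact: bounded_measurableZ].
  by rewrite meanZ// meanB// mean_cst -cE subrr mulr0 addr0.
have Wg : \int[P]_w ((V w - c) * V w - K * `|g w - V w|) <=
    \int[P]_w ((V w - c) * g w).
  apply: le_mean => [||w].
  - by apply: bounded_measurableB; [exact: bounded_measurableM|exact: bounded_measurableZ].
  - exact: bounded_measurableM.
  - rewrite lerBlDr -lerBlDl -mulrBr (le_trans (ler_norm _))// normrM (distrC (V w) (g w)).
    exact: ler_wpM2r.
apply: lt_le_trans Wg.
rewrite meanB; [|exact: bounded_measurableM|exact: bounded_measurableZ].
rewrite meanZ// WV subr_gt0.
have : \int[P]_w `|g w - V w| <= sigma / (2 * (K + 1)).
  by rewrite -lee_fin -EFin_mean.
move=> /(ler_wpM2l K0) /le_lt_trans; apply.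
rewrite mulrA ltr_pdivrMr ?mulr_gt0 ?ltr_wpDl//.
by rewrite mulrC ltr_pM2l//; lra.
Qed.

Lemma exists_small_perturbation (kappa G S : R) : 0 < kappa -> 0 <= G -> 0 <= S ->
  exists eps : R, [/\ 0 < eps, eps <= 1, eps * G <= 2^-1 & eps * S < kappa].
Proof.
(* With eps = 1 / D, each summand of [D] secures one of the upper bounds; [S + 1] in place of [S]
   makes the last one strict. *)
move=> k0 G0 S0; pose D := 1 + 2 * G + (S + 1) / kappa.
have t0 : 0 <= (S + 1) / kappa by rewrite divr_ge0 ?addr_ge0 ?(ltW k0).
have D1 : 1 <= D by rewrite /D; lra.
have D0 : 0 < D by exact: lt_le_trans D1.
have DG : 2 * G <= D by rewrite /D; lra.
have DS : (S + 1) / kappa <= D by rewrite /D; lra.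
exists D^-1; split.
- by rewrite invr_gt0.
- by rewrite invf_le1.
- by rewrite mulrC ler_pdivrMr// ler_pdivlMl.
- rewrite mulrC ltr_pdivrMr// mulrC.
  by move: DS; rewrite ler_pdivrMr//; apply: lt_le_trans; rewrite ltrDl.
Qed.

(** [W] is a version of [V] with pointwise bounds, on which all estimates are made; [V] itself is
    met only under the integral. *)
Lemma Gamma_lt (V W : Omega -> R) (A : set (Omega -> R)) g (y : 'rV[R]_d) :
  measurable_fun setT V -> bounded_measurable W -> {ae P, forall w, V w = W w} ->
  (forall w, 0 <= W w) -> y <> 0 ->
  smooth_class tau (enum 'I_d) A -> A g ->
  0 < \int[P]_w ((W w - \int[P]_w W w) * g w) ->
  (Gamma tau V y < 2%:E * sqrte ((\int[P]_w W w) * (enorm y ^+ 2 / 2))%:E)%E.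
Proof.
move=> mV bW VW W0 y0 cA Ag; set c := \int[P]_w W w; set kappa := \int[P]_w _ => k0.
have c0 : 0 <= c by apply: Rintegral_ge0.
have bg := smooth_class_bounded_measurable cA Ag.
have [mg [M gM]] := bg; have M0 : 0 <= M by rewrite (le_trans _ (gM point)).
pose m := \int[P]_w g w.
have mM : `|m| <= M by exact: normr_mean_le.
have gmM w : `|g w - m| <= 2 * M.
  by rewrite (le_trans (ler_normB _ _))// mulr_natl mulr2n lerD.
have bgm : bounded_measurable (fun w => g w - m).
  by apply: bounded_measurableB => //; exact: bounded_measurable_cst.
have [D AD gD] := smooth_class_gradient cA Ag.
have /choice[Q DQ] : forall i, exists N : R, forall w, `|D i w| <= N.
  by move=> i; exact: smooth_class_bounded cA _ (AD i).
pose q := \sum_(i < d) Q i ^+ 2.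
have q0 : 0 <= q by apply: sumr_ge0 => i _; exact: sqr_ge0.
have gq w : enorm (gradient tau g w) ^+ 2 <= q.
  rewrite enorm_sqr; apply: ler_sum => i _; rewrite gD.
  by rewrite -(real_normK (num_real (D i w))) lerXn2r// nnegrE (le_trans _ (DQ i w)).
(* This number is the coefficient of eps^2 in the final bound for [a * b] divided by |y|^2 / 2: [q]
   from the gradient, the rest from the second factor, using a <= c + q. *)
have S0 : 0 <= q + 8 * M ^+ 2 * (c + q).
  by rewrite addr_ge0// mulr_ge0 ?addr_ge0// mulr_ge0// sqr_ge0.
have [eps [eps0 eps1 epsM epsk]] :=
  exists_small_perturbation k0 (mulr_ge0 (ler0n R 2) M0) S0.
pose x w := eps * (g w - m).
have bx : bounded_measurable x by exact: bounded_measurableZ.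
have xM w : `|x w| <= eps * (2 * M).
  by rewrite normrM (gtr0_norm eps0) ler_wpM2l// ltW.
have x2 w : `|x w| <= 2^-1 by exact: le_trans (xM w) epsM.
have mx : \int[P]_w x w = 0.
  rewrite meanZ// meanB//; last exact: bounded_measurable_cst.
  by rewrite mean_cst subrr mulr0.
(* The affine form in [g] is the one covered by [smooth_class_affine] and [gradient_affine]; the
   estimates use 1 - x instead. *)
pose f w := (1 + eps * m) + (- eps) * g w.
have fE w : f w = 1 - x w by rewrite /f /x; ring.
have b1 := bounded_measurable_cst (Omega := Omega) (1 : R).
have bf : bounded_measurable f.
  rewrite (_ : f = (fun w => 1 - x w)); first exact: bounded_measurableB.
  by apply/funext => w; exact: fE.
have f2 w : 2^-1 <= f w.
  by rewrite fE; have := x2 w; rewrite ler_norml => /andP[? ?]; lra.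
have f0 w : 0 < f w by rewrite (lt_le_trans _ (f2 w)).
have Ff : classF tau f.
  split.
  - by apply/Lfun1_integrable; exact: bounded_measurable_integrable.
  - rewrite unlock EFin_mean//; congr EFin; under eq_Rintegral do rewrite fE.
    by rewrite meanB// mean_cst mx subr0.
  - by exists 2^-1 => //; rewrite invr_gt0.
  - have cA' := smooth_class_affine (- eps) cA.
    apply: (smooth_class_smooth_bounded cA').
    by exists g => //; exists (1 + eps * m).
(* Since f >= 1/2, the gradient term |grad f|^2 / (8 f) is at most eps^2 q, and E(W f) = c - eps
   kappa exactly. *)
pose a := c - eps * kappa + eps ^+ 2 * q.
(* The correction is 2 x^2 with |x| <= 2 eps M, from 1 / (1 - x) <= 1 + x + 2 x^2; the linear term
   has mean zero. *)
pose b := enorm y ^+ 2 / 2 * (1 + 8 * eps ^+ 2 * M ^+ 2).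
have y20 := enorm_sqr_gt0 y0.
pose H w := eps ^+ 2 * q + W w * f w.
have bH : bounded_measurable H.
  by apply: bounded_measurableD; [exact: bounded_measurable_cst|exact: bounded_measurableM].
have H0 w : 0 <= H w.
  by rewrite addr_ge0// mulr_ge0// ?sqr_ge0// ltW.
have meanH : \int[P]_w H w = a.
  rewrite meanD; [|exact: bounded_measurable_cst|exact: bounded_measurableM].
  rewrite mean_cst addrC; congr (_ + _).
  transitivity (\int[P]_w (W w - eps * (W w * g w - m * W w))).
    by apply: eq_Rintegral => w _; rewrite /f; ring.
  have bWg := bounded_measurableM bW bg.
  have bmW := bounded_measurableZ m bW.
  have bWgm := bounded_measurableB bWg bmW.
  rewrite meanB//; last exact: bounded_measurableZ.
  rewrite meanZ// meanB// meanZ// -/c; congr (_ - _ * _).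
  rewrite /kappa; transitivity (\int[P]_w (W w * g w - c * g w)).
    by rewrite meanB//; [rewrite meanZ// (mulrC m)|exact: bounded_measurableZ].
  by apply: eq_Rintegral => w _; ring.
have a0 : 0 <= a by rewrite -meanH; apply: Rintegral_ge0 => w _; exact: H0.
have fa : (\int[P]_w (enorm (gradient tau f w) ^+ 2 / (8 * f w) + V w * f w)%:E
    <= a%:E)%E.
  (* [V] may be negative on a null set. The pointwise comparison is therefore made with the positive
     part of [HV], which equals [H] almost everywhere. *)
  pose HV w : R := eps ^+ 2 * q + V w * f w.
  apply: (@le_trans _ _ (\int[P]_w (fun w => (HV w)%:E)^\+ w)%E).
    apply: le_integral_funepos => w; rewrite lee_fin lerD2r.
    rewrite (gradient_affine _ _ _ cA Ag) enorm_sqr.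
    under eq_bigr do rewrite mxE exprMn sqrrN.
    rewrite -mulr_sumr -enorm_sqr ler_pdivrMr ?mulr_gt0//.
    rewrite -[leRHS]mulrA ler_wpM2l ?sqr_ge0// (le_trans (gq w))//.
    by rewrite -[leLHS]mulr1 ler_wpM2l//; have := f2 w; lra.
  rewrite -meanH -EFin_mean//.
  rewrite (@ge0_ae_eq_integral _ _ _ _ _ _ (fun w => (H w)%:E))//.
  - apply: measurable_funepos; apply/measurable_EFinP; apply: measurable_funD => //.
    by apply: measurable_funM => //; have [] := bf.
  - by apply/measurable_EFinP; have [] := bH.
  - by move=> w _; rewrite lee_fin.
  - move: VW; apply: filterS => w VWw _.
    by rewrite funeposE /HV VWw -/(H w) max_l// lee_fin.
have fb : (\int[P]_w (enorm y ^+ 2 / (2 * f w))%:E <= b%:E)%E.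
  pose B w := enorm y ^+ 2 / 2 * (1 + x w + 8 * eps ^+ 2 * M ^+ 2).
  have bB : bounded_measurable B.
    apply: bounded_measurableZ; apply: bounded_measurableD.
      exact: bounded_measurableD.
    exact: bounded_measurable_cst.
  have -> : b = \int[P]_w B w.
    rewrite meanZ; last first.
      apply: bounded_measurableD; [exact: bounded_measurableD|exact: bounded_measurable_cst].
    rewrite meanD; [|exact: bounded_measurableD|exact: bounded_measurable_cst].
    by rewrite meanD// !mean_cst mx addr0.
  rewrite -EFin_mean//; apply: le_ge0_integral => w; rewrite lee_fin.
    by rewrite divr_ge0 ?sqr_ge0// mulr_ge0// ltW.
  rewrite invfM mulrA ler_wpM2l ?divr_ge0 ?sqr_ge0//.
  (* 1 / (1 - t) <= 1 + t + 2 t^2 for |t| <= 1 / 2, with t = x w *)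
  rewrite -[leLHS]mul1r ler_pdivrMr// fE.
  have x4 : x w ^+ 2 <= eps ^+ 2 * (4 * M ^+ 2).
    rewrite -(real_normK (num_real (x w))) (_ : eps ^+ 2 * _ = (eps * (2 * M)) ^+ 2).
      by rewrite lerXn2r// nnegrE// mulr_ge0 ?mulr_ge0// ltW.
    by ring.
  have := x2 w; rewrite ler_norml => /andP[x5 x6].
  nra.
apply: (le_lt_trans (Gamma_le Ff a0 fa fb)).
have ab : a * b < c * (enorm y ^+ 2 / 2).
  rewrite /b mulrCA [ltRHS]mulrC ltr_pM2l ?divr_gt0//.
  have aS : a <= c + q.
    rewrite /a lerD// ?lerBlDr ?lerDl ?mulr_ge0 ?(ltW eps0) ?(ltW k0)//.
    by rewrite -[leRHS]mul1r ler_wpM2r// expr_le1// ltW.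
  have : a * (8 * eps ^+ 2 * M ^+ 2) <= (c + q) * (8 * eps ^+ 2 * M ^+ 2).
    by rewrite ler_wpM2r// (mulr_ge0 (mulr_ge0 (ler0n R 8) (sqr_ge0 _)) (sqr_ge0 _)).
  have : eps * (eps * (q + 8 * M ^+ 2 * (c + q))) < eps * kappa by rewrite ltr_pM2l.
  move=> h1 h2; rewrite [a * _]mulrDr mulr1.
  apply: (le_lt_trans (lerD (lexx a) h2)).
  rewrite (_ : eps * (eps * _) =
    eps ^+ 2 * q + (c + q) * (8 * eps ^+ 2 * M ^+ 2)) in h1; last by ring.
  by rewrite {1}/a; lra.
have ab0 : 0 <= a * b.
  rewrite mulr_ge0// -lee_fin (le_trans _ fb)// integral_ge0// => w _.
  by rewrite lee_fin divr_ge0 ?sqr_ge0// mulr_ge0// ltW.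
rewrite /= -!EFinM lte_fin ltr_pM2l// ltr_sqrt//.
exact: le_lt_trans ab.
Qed.
End perturbation.

Theorem theorem3p2 (R : realType) (d : nat) (dO : measure_display)
    (Omega : measurableType dO) (P : probability Omega R)
    (tau : metric_dynamical_system d P)
    (V : Omega -> R) (gradV : Omega -> 'rV[R]_d) (vmin vmax : R)
    (V_potential : potential P V)
    (V_nondet : nondeterministic P V)
    (V_weakly_diff : is_weak_gradient tau V gradV)
    (gradV_bounded : (ess_sup P (fun w => (enorm (gradV w))%:E) < +oo)%E)
    (vmin_gt0 : 0 < vmin)
    (V_bounds : {ae P, forall w, vmin <= V w <= vmax})
    (y : 'rV[R]_d) (y_neq0 : y <> 0) :
  (Gamma tau V y < Gamma tau (fun=> fine 'E_P[V]) y)%E.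
Proof.
have [/Lfun1_integrable/measurable_int/measurable_EFinP mV _] := V_potential.
(* The bounds on [V] hold almost surely; clamping makes them hold everywhere and changes [V] on a
   null set only. *)
pose W w := Num.max vmin (Num.min (V w) vmax).
have W0 w : 0 <= W w by rewrite le_max ltW.
have bW : bounded_measurable W.
  split; first by apply: measurable_maxr => //; exact: measurable_minr.
  exists (vmin + `|vmax|) => w; rewrite ger0_norm// ge_max lerDl normr_ge0/=.
  by rewrite ge_min (le_trans (ler_norm vmax)) ?orbT// lerDr ltW.
have VW : {ae P, forall w, V w = W w}.
  move: V_bounds; apply: filterS => w /andP[Vmin Vmax].
  by rewrite /W min_l// max_r.
have -> : fine 'E_P[V] = \int[P]_w W w.
  rewrite unlock /Rintegral; congr fine; apply: ae_eq_integral => //.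
  - exact/measurable_EFinP.
  - by apply/measurable_EFinP; have [] := bW.
  - by move: VW; apply: filterS => w -> _.
set c := \int[P]_w W w.
have c0 : 0 <= c by apply: Rintegral_ge0.
have bWc : bounded_measurable (fun w => (W w - c) ^+ 2).
  have bD := bounded_measurableB bW (bounded_measurable_cst c).
  by under eq_fun do rewrite expr2; exact: bounded_measurableM.
(* Zero variance would force W = c, hence V = c, almost surely, against nondeterminism. *)
have var_gt0 : 0 < \int[P]_w ((W w - c) ^+ 2).
  rewrite lt0r Rintegral_ge0 ?andbT; last by move=> w _; exact: sqr_ge0.
  apply/eqP => var0; apply: V_nondet; exists c.
  have /ae_eq_integral_abs : measurable_fun setT (fun w => ((W w - c) ^+ 2)%:E).
    by apply/measurable_EFinP; have [] := bWc.
  move=> /(_ P measurableT)[+ _]; rewrite /abse.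
  under eq_integral do rewrite /= ger0_norm ?sqr_ge0//.
  rewrite EFin_mean// var0 => /(_ erefl); apply: filterS2 VW => w -> /(_ I)[].
  by move=> /eqP; rewrite sqrf_eq0 subr_eq0 => /eqP.
have [A [g [cA Ag Wg]]] := exists_smooth_correlated tau bW erefl var_gt0.
exact: (lt_le_trans (Gamma_lt mV bW VW W0 y_neq0 cA Ag Wg) (Gamma_cst_ge tau y c0)).
Qed.
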